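(* If a finite group $G$ is a pseudo-$M$-group, then $G$ is a pseudo-$M_p$-group for every prime $p$.
   Context: All groups are finite. $\mathrm{Irr}(G)$ is the set of irreducible complex characters of $G$, and for a prime $p$, $\mathrm{IBr}(G)$ is the set of irreducible Brauer characters of $G$ with respect to $p$; $\psi^G$ denotes induction of (Brauer) characters. For $\chi\in\mathrm{Irr}(G)$ put $D(\chi)=\{\psi(1)\mid \psi\in\mathrm{Irr}(H)\text{ for some }H\le G\text{ and }\psi^G=\chi\}$. The group $G$ is a pseudo-$M$-group if $\gcd(D(\chi))=1$ for every $\chi\in\mathrm{Irr}(G)$. For $\varphi\in\mathrm{IBr}(G)$ put $S(\varphi)=\{\psi\in\mathrm{IBr}(H)\mid H\le G,\ \psi^G=\varphi\}$; $\varphi$ is pseudo monomial if $\gcd\{\psi(1)\mid\psi\in S(\varphi)\}=1$. The group $G$ is a pseudo-$M_p$-group if every $\varphi\in\mathrm{IBr}(G)$ is pseudo monomial. Subgroups $H$ are allowed to equal $G$. *)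

(* Defs.v *)
From HB Require Import structures.
From mathcomp Require Import all_boot all_order all_algebra all_fingroup.
From mathcomp Require Import all_solvable all_field all_character.

Set Implicit Arguments.
Unset Strict Implicit.
Unset Printing Implicit Defensive.

Import GroupScope GRing.Theory.
Local Open Scope ring_scope.

(* The ring of all algebraic integers in the field algC of algebraic numbers. *)
Record algInt : Type := AlgInt { algInt_val :> algC; _ : algInt_val \in Aint }.

HB.instance Definition _ := [isSub for algInt_val].
HB.instance Definition _ := [Choice of algInt by <:].
HB.instance Definition _ := [SubChoice_isSubComNzRing of algInt by <:].

(* A surjection red : algInt -> F onto a field of characteristic p is the same
   thing as a maximal ideal M (its kernel) of the ring of algebraic integers
   with p \in M, together with an identification of F with the residue field,
   which is algebraically closed. Brauer characters are defined relative to
   such a choice. *)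
Definition residue_map (p : nat) (F : closedFieldType)
    (red : {rmorphism algInt -> F}) : Prop :=
  p \in [pchar F] /\ (forall y : F, exists z : algInt, red z = y).

Definition p'_root_of_unity (p : nat) (z : algInt) : Prop :=
  exists2 k : nat, p^'.-nat k & z ^+ k = 1.

(* phi is the Brauer character afforded by rG. Brauer characters, which are
   functions on the p-regular elements of G, are represented by class functions
   extended by 0 to the whole of G. Since conjugation preserves p-regularity,
   'Ind of such a class function is again zero off the p-regular elements, and
   is given on them by the usual formula for induced Brauer characters.
   The eigenvalues of rG x, for x p-regular, are roots of unity of order prime
   to p, and red is bijective from the complex roots of unity of order prime to
   p to those in F, so s is unique up to permutation. *)
Definition affords_brauer (p : nat) (F : closedFieldType)
    (red : {rmorphism algInt -> F}) (gT : finGroupType) (G : {group gT})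
    (n : nat) (rG : mx_representation F G n) (phi : 'CF(G)) : Prop :=
  (forall x, x \in G -> p^'.-elt x ->
     exists s : seq algInt,
       [/\ {in s, forall z, p'_root_of_unity p z},
           char_poly (rG x) = \prod_(z <- s) ('X - (red z)%:P)
         & phi x = \sum_(z <- s) (z : algC)])
  /\ (forall x, x \in G -> ~~ p^'.-elt x -> phi x = 0).

Definition IBr (p : nat) (F : closedFieldType) (red : {rmorphism algInt -> F})
    (gT : finGroupType) (G : {group gT}) (phi : 'CF(G)) : Prop :=
  exists (n : nat) (rG : mx_representation F G n),
    mx_irreducible rG /\ affords_brauer p red rG phi.

Definition gcd_eq1 (D : nat -> Prop) : Prop :=
  forall d : nat, (forall n, D n -> (d %| n)%N) -> d = 1%N.

Definition inducing_degree (gT : finGroupType) (G : {group gT}) (chi : 'CF(G))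
    (n : nat) : Prop :=
  exists (H : {group gT}) (psi : 'CF(H)),
    [/\ H \subset G, psi \in irr H, 'Ind[G] psi = chi & psi 1%g = n%:R].

Definition pseudoM_group (gT : finGroupType) (G : {group gT}) : Prop :=
  forall chi : 'CF(G), chi \in irr G -> gcd_eq1 (inducing_degree chi).

Definition brauer_inducing_degree (p : nat) (F : closedFieldType)
    (red : {rmorphism algInt -> F}) (gT : finGroupType) (G : {group gT})
    (phi : 'CF(G)) (n : nat) : Prop :=
  exists (H : {group gT}) (psi : 'CF(H)),
    [/\ H \subset G, IBr p red psi, 'Ind[G] psi = phi & psi 1%g = n%:R].

Definition pseudo_monomial (p : nat) (F : closedFieldType)
    (red : {rmorphism algInt -> F}) (gT : finGroupType) (G : {group gT})
    (phi : 'CF(G)) : Prop :=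
  gcd_eq1 (brauer_inducing_degree p red phi).

Definition pseudoMp_group (p : nat) (F : closedFieldType)
    (red : {rmorphism algInt -> F}) (gT : finGroupType) (G : {group gT}) :
    Prop :=
  forall phi : 'CF(G), IBr p red phi -> pseudo_monomial p red phi.

(* Main.v *)
(* A pseudo-M-group G is solvable: if K = [K, K] is normal in G and
   chi = psi^G is irreducible, then by induction on chi(1) the group K lies in
   the kernel of every constituent of 1_H^G, so K is contained in H; hence the
   degree of the constituents of chi_K divides every psi(1), so it is 1 and
   K is contained in ker chi.

   By the Fong-Swan theorem an irreducible representation V of G in
   characteristic p then lifts to a complex character chi. If chi = psi^G, the
   reduction of psi modulo p is irreducible: a proper submodule would, lifting
   the submodule and the quotient to H and inducing, write the trace of V as a
   sum of traces of representations of smaller degree. So every psi inducing chi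
   restricts to an irreducible Brauer character inducing that of V.

   That last contradiction rests on the following: the trace of V is not a
   linear combination of traces of representations of degree at most dim V none
   of which is isomorphic to V. Here "chi lifts V" means chi(1) = dim V and
   tr V = chi mod p on all of G.

   For Fong-Swan, if V is not homogeneous over some normal subgroup it is induced
   from a proper subgroup by Clifford theory. Otherwise one climbs a chief
   series, carrying an invariant complex lift theta, of degree and determinantal
   order prime to p, of the irreducible constituents of V on the current normal
   subgroup: theta extends canonically over a p-quotient by Gallagher's
   coprimality theorem, while over an r-quotient, r != p, the constituents of V
   are lifted through a chain of subgroups of index r, and the lifts are
   invariant because a character whose restriction is a multiple of theta is
   determined by its values on the p-regular elements. *)
Require Import Defs.
From HB Require Import structures.
From mathcomp Require Import all_boot all_order all_algebra all_fingroup.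
From mathcomp Require Import all_solvable all_field all_character.
From mathcomp Require Import ring.
From Stdlib Require Import Classical.

Set Implicit Arguments.
Unset Strict Implicit.
Unset Printing Implicit Defensive.

Import Order.TTheory GroupScope GRing.Theory Num.Theory.
Local Open Scope ring_scope.

(** * Linear independence of traces of irreducible representations *)

Section Homomorphisms.

Variables (F : closedFieldType) (gT : finGroupType) (G : {group gT}).
Local Notation rep := (mx_representation F G).

Lemma hom_irr_row_free n m (X : rep n) (Y : rep m) (f : 'M_(n, m)) :
    mx_irreducible X -> f != 0 ->
    (forall x, x \in G -> X x *m f = f *m Y x) ->
  row_free f.
Proof.
case/mx_irrP=> n_gt0 irrX nzf homf; rewrite -kermx_eq0; apply/eqP.
have modK : mxmodule X (kermx f).
  apply/mxmoduleP=> x Gx; apply/sub_kermxP.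
  by rewrite -mulmxA homf // mulmxA mulmx_ker mul0mx.
apply/eqP; apply: contraR nzf => nzK.
have := irrX _ modK nzK; rewrite -sub1mx => /sub_kermxP.
by rewrite mul1mx => ->.
Qed.

Lemma hom_irr_rsim n m (X : rep n) (Y : rep m) (f : 'M_(n, m)) :
    mx_irreducible X -> mx_irreducible Y -> f != 0 ->
    (forall x, x \in G -> X x *m f = f *m Y x) ->
  mx_rsim X Y.
Proof.
move=> irrX irrY nzf homf; have freef := hom_irr_row_free irrX nzf homf.
case/mx_irrP: irrY => m_gt0 irrY.
have modf : mxmodule Y f.
  by apply/mxmoduleP=> x Gx; rewrite -homf // submxMl.
have fullf : row_full <<f>>%MS.
  by apply: irrY; rewrite ?(eqmx_module _ (genmxE _)) // (eqmx_eq0 (genmxE _)).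
exists f => //; apply: etrans (eqP fullf); rewrite genmxE.
by apply/esym/eqP.
Qed.

(** A relation between representations rather than a submodule matrix, so that constituents can be
    composed down a chain of subgroups. *)
Definition emb n m (X : rep n) (Y : rep m) : Prop :=
  exists2 B : 'M_(n, m), row_free B &
    forall x, x \in G -> X x *m B = B *m Y x.

Lemma emb_refl n (X : rep n) : emb X X.
Proof.
by exists 1%:M => [|x _]; rewrite ?row_free_unit ?unitmx1 ?mul1mx ?mulmx1.
Qed.

Lemma emb_trans n m l (X : rep n) (Y : rep m) (Z : rep l) :
  emb X Y -> emb Y Z -> emb X Z.
Proof.
case=> A freeA homA [B freeB homB]; exists (A *m B).
  by rewrite /row_free mxrankMfree.
by move=> x Gx; rewrite mulmxA homA // -!mulmxA homB.
Qed.

Lemma emb_submod n (X : rep n) (U : 'M_n) (modU : mxmodule X U) :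
  emb (submod_repr modU) X.
Proof.
exists (val_submod 1%:M); first by rewrite /row_free val_submod1.
by move=> x Gx; rewrite -(val_submodJ modU) // mul1mx -val_submodE.
Qed.

Lemma irr_emb_exists n (X : rep n) :
  (0 < n)%N -> exists m, exists2 Y : rep m, mx_irreducible Y & emb Y X.
Proof.
move=> n_gt0; have nz1 : (1%:M : 'M[F]_n) != 0.
  by rewrite -mxrank_eq0 mxrank1 -lt0n.
have [U simU _] := dec_mxsimple_exists (mxmodule1 X) nz1.
exists (\rank U), (submod_repr (mxsimple_module simU)).
  exact/submod_mx_irr.
exact: emb_submod.
Qed.

End Homomorphisms.

(** * Separating irreducible representations by elements of the group algebra *)

Section Annihilators.

Variables (F : closedFieldType) (gT : finGroupType) (G : {group gT}).
Local Notation rep := (mx_representation F G).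
Local Notation aG := (regular_repr F G).
Local Notation "a ** b" := (a *m gring_mx aG b) (at level 40).
Local Notation one := (gring_row (1%:M : 'M[F]_#|G|)).

Lemma gring_mx_one n (V : rep n) : gring_mx V one = 1%:M.
Proof. by rewrite -gring_opE gring_op1. Qed.

(** A preimage of [A] in the group algebra. It is a genuine one when [V] is irreducible: by
    Burnside's theorem over a closed field the matrices of [V] span the full matrix algebra. *)
Definition gring_lift n (V : rep n) (A : 'M_n) : 'rV_#|G| :=
  mxvec A *m pinvmx (enveloping_algebra_mx V).

Lemma gring_liftK n (V : rep n) :
  mx_irreducible V -> cancel (gring_lift V) (gring_mx V).
Proof.
move=> irrV A; have /andP[_ fullV]: mx_absolutely_irreducible V.
  exact: group_closure_closed_field.
by rewrite /gring_mx /= mulmxKpV ?mxvecK ?submx_full.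
Qed.

(** The annihilator of [X] is a two-sided ideal. If it acts nontrivially on [V], its image is a
    nonzero ideal of a full matrix algebra and contains 1. Otherwise the action on [V] factors
    through that on [X], which makes the two similar. *)
Lemma irr_separate2 n m (V : rep n) (X : rep m) :
    mx_irreducible V -> mx_irreducible X -> ~ mx_rsim X V ->
  exists a, gring_mx V a = 1%:M /\ gring_mx X a = 0.
Proof.
move=> irrV irrX not_sim.
have [[n_gt0 _] [m_gt0 _]] := ((mx_irrP V).1 irrV, (mx_irrP X).1 irrX).
have [a Xa0 nzVa] : exists2 a, gring_mx X a = 0 & gring_mx V a != 0.
  pose E := enveloping_algebra_mx X.
  have [/eqP K0 | nzK] := boolP (kermx E *m enveloping_algebra_mx V == 0); last first.
    have [i nzi] : exists i, row i (kermx E *m enveloping_algebra_mx V) != 0.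
      apply/existsP; apply: contraR nzK; rewrite negb_exists => /forallP z.
      by apply/eqP/row_matrixP=> i; rewrite row0; apply/eqP/negPn/z.
    exists (row i (kermx E)).
      by rewrite /gring_mx /= -row_mul mulmx_ker row0 linear0.
    apply: contra nzi; rewrite /gring_mx /= -row_mul => /eqP/(congr1 mxvec).
    by rewrite vec_mxK linear0 => ->.
  (* Here the annihilator of [X] kills [V], so [W] below is a well-defined algebra morphism between
     the two matrix rings, taking the action on [X] to the action on [V]. *)
  have wd a b : gring_mx X a = gring_mx X b -> gring_mx V a = gring_mx V b.
    move=> eqX; apply/eqP; rewrite -subr_eq0 -linearB /=.
    have /submxP[c ->] : (a - b <= kermx E)%MS.
      apply/sub_kermxP; rewrite -[LHS]vec_mxK.
      have -> : vec_mx ((a - b) *m E) = gring_mx X (a - b) by [].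
      by rewrite linearB /= eqX subrr linear0.
    by rewrite /gring_mx /= -mulmxA K0 mulmx0 linear0.
  pose al := gring_lift X; have alK : cancel al (gring_mx X) := gring_liftK irrX.
  pose W A := gring_mx V (al A).
  have WX a : W (gring_mx X a) = gring_mx V a by apply: wd; rewrite alK.
  have WM A B : W (A *m B) = W A *m W B.
    by rewrite -gring_mxA -{1}(alK A) -{1}(alK B) -gring_mxA WX.
  have W1 : W 1%:M = 1%:M by rewrite -(gring_mx_one X) WX gring_mx_one.
  have W_sum (I : finType) (c : I -> F) (B : I -> 'M_m) :
      W (\sum_i c i *: B i) = \sum_i c i *: W (B i).
    rewrite /W /al /gring_lift (linear_sum mxvec) mulmx_suml linear_sum /=.
    by apply: eq_bigr => i _; rewrite linearZ /= -scalemxAl linearZ.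
  pose i0 := Ordinal m_gt0.
  have nzW : W (delta_mx i0 i0) != 0.
    apply/eqP=> W0; have /eqP := W1; rewrite mx1_sum_delta.
    rewrite (eq_bigr (fun i => (1 : F) *: delta_mx i i)) => [|i _]; last first.
      by rewrite scale1r.
    rewrite W_sum big1 => [|i _].
      by rewrite eq_sym -mxrank_eq0 mxrank1 -leqn0 leqNgt n_gt0.
    rewrite -(mul_delta_mx i0) -[delta_mx i i0](mul_delta_mx i0) !WM W0.
    by rewrite mulmx0 mul0mx scaler0.
  have [r nzr] : exists r, row r (W (delta_mx i0 i0)) != 0.
    apply/existsP; apply: contraR nzW; rewrite negb_exists => /forallP z.
    by apply/eqP/row_matrixP=> i; rewrite row0; apply/eqP/negPn/z.
  (* The span of the matrix units [delta_mx i0 j] is a right ideal isomorphic to [X]; applying [W]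
     and taking a nonzero row [r] gives a nonzero homomorphism from [X] to [V]. *)
  pose f := \matrix_(j < m) row r (W (delta_mx i0 j)).
  case: not_sim; apply: (hom_irr_rsim (f := f)) => //.
    apply: contra nzr => /eqP f0; have := rowK (fun j => row r (W (delta_mx i0 j))) i0.
    by rewrite -/f f0 row0 => <-.
  move=> x Gx; apply/row_matrixP=> j; rewrite !row_mul rowK -[RHS]row_mul.
  have VxE : V x = W (X x).
    rewrite -[in RHS](gring_opG X Gx) gring_opE WX -gring_opE gring_opG //.
  rewrite VxE -WM; rewrite mulmx_sum_row.
  have -> : delta_mx i0 j *m X x = \sum_k X x j k *: delta_mx i0 k.
    apply/matrixP=> a b; rewrite summxE !mxE (bigD1 j) //= big1 ?addr0 => [|k nkj].
      rewrite (bigD1 b) //= big1 ?addr0 => [|k nkb].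
        by rewrite !mxE !eqxx !andbT mulrC.
      by rewrite !mxE [b == k]eq_sym (negPf nkb) andbF mulr0.
    by rewrite !mxE (negPf nkj) andbF mul0r.
  rewrite W_sum (linear_sum (row r)) /=; apply: eq_bigr => k _.
  by rewrite linearZ /= rowK [row j (X x) 0 k]mxE.
have [i /existsP[j nzij]] : exists i, [exists j, gring_mx V a i j != 0].
  apply/existsP; apply: contraR nzVa; rewrite negb_exists => /forallP z.
  apply/eqP/matrixP=> i j; rewrite [RHS]mxE; apply/eqP; have := z i.
  by rewrite negb_exists => /forallP/(_ j)/negPn.
(* With A the image of [a] in [V], E_ki A E_jk = A_ij E_kk; dividing by A_ij and summing over k
   gives the identity. *)
pose b := \sum_k (gring_mx V a i j)^-1 *:
  (gring_lift V (delta_mx k i) ** a ** gring_lift V (delta_mx j k)).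
exists b; rewrite !linear_sum; split; last first.
  rewrite big1 // => k _; rewrite linearZ /= !gring_mxA Xa0.
  by rewrite mulmx0 mul0mx scaler0.
rewrite mx1_sum_delta; apply: eq_bigr => k _; rewrite linearZ /= !gring_mxA.
rewrite !gring_liftK // {2}[gring_mx V a]matrix_sum_delta.
rewrite mulmx_sumr mulmx_suml (bigD1 i) //= [X in _ + X]big1 ?addr0.
  rewrite mulmx_sumr mulmx_suml (bigD1 j) //= [X in _ + X]big1 ?addr0.
    rewrite -scalemxAr mul_delta_mx -scalemxAl mul_delta_mx scalerA.
    by rewrite mulVf ?scale1r.
  move=> l nlj; rewrite -scalemxAr mul_delta_mx -scalemxAl.
  by rewrite mul_delta_mx_0 // scaler0.
move=> l nli; rewrite mulmx_sumr mulmx_suml big1 // => l' _.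
by rewrite -scalemxAr mul_delta_mx_0 1?eq_sym // scaler0 mul0mx.
Qed.

Lemma tr_gring_mx n (X : rep n) a :
  \tr (gring_mx X a) = \sum_i a 0 i * \tr (X (enum_val i)).
Proof.
rewrite /gring_mx /= mulmx_sum_row !linear_sum; apply: eq_bigr => i _ /=.
by rewrite !linearZ /= rowK mxvecK.
Qed.

Lemma tr_gring_mx_sub_fact n (X : rep n) (U : 'M_n) (modU : mxmodule X U) a :
  \tr (gring_mx X a) =
    \tr (gring_mx (submod_repr modU) a) + \tr (gring_mx (factmod_repr modU) a).
Proof.
rewrite !tr_gring_mx -big_split; apply: eq_bigr => i _ /=.
by rewrite -(mxtrace_sub_fact_mod modU) mulrDr.
Qed.

Lemma factmod_rank n (U : 'M[F]_n) : (\rank U + \rank (cokermx U))%N = n.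
Proof. by rewrite mxrank_coker subnKC ?rank_leq_row. Qed.

(* The trace form of X vanishes on the ideal spanned by c, while V maps c to 1:
   the trace of V cannot be a combination of traces of such X. *)
Lemma irr_separate n (V : rep n) m (X : rep m) :
    mx_irreducible V -> (m <= n)%N -> ~ mx_rsim X V ->
  exists c, gring_mx V c = 1%:M /\
    (forall a, \tr (gring_mx X (a ** c)) = 0).
Proof.
move=> irrV; elim/ltn_ind: m X => m IHm X le_mn not_sim.
have [m0 | m_gt0] := posnP m.
  exists one; split=> [|a]; first exact: gring_mx_one.
  by rewrite [\tr _]big1 // => i; have := ltn_ord i; rewrite [X in (_ < X)%N]m0.
have nz1 : (1%:M : 'M[F]_m) != 0 by rewrite -mxrank_eq0 mxrank1 -lt0n.
have [|simX] := mxnonsimpleP X nz1; last first.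
  have [c [Vc Xc]] : exists c, gring_mx V c = 1%:M /\ gring_mx X c = 0.
    by apply: irr_separate2 => //; apply/mxsimpleP; rewrite mxmodule1.
  by exists c; split=> // a; rewrite gring_mxA Xc mulmx0 linear0.
case=> U /and4P[modU _ nzU ltU].
have rkU := factmod_rank U; rewrite mxrank1 in ltU.
have rkU_gt0 : (0 < \rank U)%N by rewrite lt0n mxrank_eq0.
have rk'U : (\rank (cokermx U) < m)%N by rewrite -[X in (_ < X)%N]rkU -{1}[\rank (cokermx U)]add0n ltn_add2r.
have [||c1 [Vc1 tr1]] := IHm _ ltU (submod_repr modU).
- exact: leq_trans (ltnW ltU) le_mn.
- by case=> B eq_n _ _; move: ltU; rewrite eq_n ltnNge le_mn.
have [||c2 [Vc2 tr2]] := IHm _ rk'U (factmod_repr modU).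
- exact: leq_trans (ltnW rk'U) le_mn.
- by case=> B eq_n _ _; move: rk'U; rewrite eq_n ltnNge le_mn.
(* On the quotient [c2] already stands on the right; on the submodule a cyclic permutation under the
   trace brings [c1] there. *)
exists (c1 ** c2); split=> [|a]; first by rewrite gring_mxA Vc1 Vc2 mulmx1.
rewrite (tr_gring_mx_sub_fact modU).
have -> : gring_mx (factmod_repr modU) (a ** (c1 ** c2)) =
          gring_mx (factmod_repr modU) ((a ** c1) ** c2).
  by rewrite !gring_mxA mulmxA.
rewrite tr2 addr0 -(tr1 (c2 ** a)) !gring_mxA mulmxA mxtrace_mulC !mulmxA.
by [].
Qed.

(** If no [X i] is similar to [V], the product of the separating elements acts as 1 on [V] and
    annihilates the trace forms of all the [X i] at once. *)
Lemma irr_trace_indep n (V : rep n) (I : finType) (m : I -> nat)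
    (X : forall i, rep (m i)) (k : I -> F) :
    mx_irreducible V ->
    (forall x, x \in G -> \tr (V x) = \sum_i k i * \tr (X i x)) ->
    (forall i, (m i <= n)%N) ->
  exists i, mx_rsim (X i) V.
Proof.
move=> irrV trV le_mn; apply: NNPP => nsim.
have [n_gt0 _] := (mx_irrP V).1 irrV; pose i0 := Ordinal n_gt0.
have [c [Vc Xc]] : exists c, gring_mx V c = 1%:M /\
    (forall i a, \tr (gring_mx (X i) (a ** c)) = 0).
  have sep i : exists c, gring_mx V c = 1%:M /\
    (forall a, \tr (gring_mx (X i) (a ** c)) = 0).
    by apply: irr_separate => // simXV; apply: nsim; exists i.
  suff [c [Vc Xc]] : exists c, gring_mx V c = 1%:M /\
    (forall i, i \in enum I -> forall a, \tr (gring_mx (X i) (a ** c)) = 0).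
    by exists c; split=> // i a; rewrite Xc ?mem_enum.
  elim: (enum I) => [|i s [c [Vc Xc]]].
    by exists one; split=> //; apply: gring_mx_one.
  have [d [Vd Xd]] := sep i; exists (d ** c); split.
    by rewrite gring_mxA Vc Vd mulmx1.
  move=> j; rewrite inE => /predU1P[->{j} a | sj a].
    rewrite -(Xd (c ** a)) !gring_mxA mulmxA mxtrace_mulC !mulmxA.
    by [].
  by rewrite -(Xc j sj (a ** d)) !gring_mxA mulmxA.
(* A matrix unit is used because the trace of the identity, [n], may vanish in [F]. *)
have [a Va] : exists a, gring_mx V a = delta_mx i0 i0.
  by exists (gring_lift V (delta_mx i0 i0)); apply: gring_liftK.
suff /eqP : (1 : F) = 0 by rewrite oner_eq0.
have <- : \tr (gring_mx V (a ** c)) = 1.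
  rewrite gring_mxA Vc mulmx1 Va /mxtrace (bigD1 i0) //= mxE !eqxx.
  by rewrite big1 ?addr0 // => i /negPf; rewrite mxE => ->.
rewrite tr_gring_mx.
rewrite (eq_bigr (fun j => \sum_i k i * ((a ** c) 0 j * \tr (X i (enum_val j))))).
  rewrite exchange_big big1 // => i _.
  by rewrite -mulr_sumr -tr_gring_mx Xc mulr0.
move=> j _; rewrite trV ?enum_valP // mulr_sumr; apply: eq_bigr => i _.
by rewrite mulrCA.
Qed.

End Annihilators.

(** * Traces on p'-parts, on cosets and on normal subgroups *)

Section Traces.

Variables (F : closedFieldType) (gT : finGroupType).
Implicit Types G H K M N : {group gT}.
Local Notation rep := (mx_representation F).

(** This plays the role of a composition series for properties that pass to extensions. *)
Lemma rep_ind G (Q : forall n, rep G n -> Prop) :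
    (forall X : rep G 0, Q 0%N X) ->
    (forall n (X : rep G n), mx_irreducible X -> Q n X) ->
    (forall n (X : rep G n) (U : 'M_n) (modU : mxmodule X U),
       (\rank U < n)%N -> (\rank (cokermx U) < n)%N ->
       Q _ (submod_repr modU) -> Q _ (factmod_repr modU) -> Q n X) ->
  forall n (X : rep G n), Q n X.
Proof.
move=> Q0 Qirr Qext n; elim/ltn_ind: n => n IHn X.
have [n0 | n_gt0] := posnP n; first by rewrite n0 in X *; apply: Q0.
have nz1 : (1%:M : 'M[F]_n) != 0 by rewrite -mxrank_eq0 mxrank1 -lt0n.
have [|simX] := mxnonsimpleP X nz1; last first.
  by apply: Qirr; apply/mxsimpleP; rewrite mxmodule1.
case=> U /and4P[modU _ nzU ltU]; rewrite mxrank1 in ltU.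
have rkU_gt0 : (0 < \rank U)%N by rewrite lt0n mxrank_eq0.
have rk'U : (\rank (cokermx U) < n)%N.
  by rewrite -[X in (_ < X)%N](factmod_rank U) -{1}[\rank (cokermx U)]add0n ltn_add2r.
by apply: (Qext n X U modU) => //; apply: IHn.
Qed.

(** The trace can be computed on the composition factors over the cyclic group of [x]. These have
    degree 1, and there the p-part acts by a root of X^(p^k) - 1 = (X - 1)^(p^k), that is, by 1. *)
Lemma mxtrace_constt_p' p G n (X : rep G n) x :
  p \in [pchar F] -> x \in G -> \tr (X x) = \tr (X x.`_p^').
Proof.
move=> pF Gx; have sCG : <[x]> \subset G by rewrite cycle_subG.
suff: forall n (X : rep <[x]> n), \tr (X x) = \tr (X x.`_p^').
  by move/(_ n (subg_repr X sCG)).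
move=> {n X} n X; pattern n, X; apply: rep_ind => {n X}.
- by move=> X; rewrite /mxtrace !big_ord0.
- move=> n X irrX; have n1 : n = 1%N.
    apply: (mx_irr_abelian_linear _ irrX (cycle_abelian x)).
    exact: group_closure_closed_field.
  rewrite {}n1 in X irrX *.
  have Cx : x \in <[x]> by apply: cycle_id.
  have Cp : x.`_p \in <[x]> by apply: mem_cycle.
  have Cp' : x.`_p^' \in <[x]> by apply: mem_cycle.
  suff Xp1 : X x.`_p = 1%:M.
    have -> : X x = X (x.`_p * x.`_p^')%g by rewrite consttC.
    by rewrite repr_mxM // Xp1 mul1mx.
  have [k] := p_natP (p_elt_constt p x) => ordk.
  have : X x.`_p ^+ (p ^ k) = 1.
    by rewrite -repr_mxX // -ordk expg_order repr_mx1.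
  rewrite [X x.`_p]mx11_scalar; move: (X x.`_p 0 0) => a.
  rewrite -(rmorphXn (@scalar_mx F 1)) => /(congr1 (fun A : 'M_1 => A 0 0)).
  rewrite !mxE !eqxx !mulr1n => ak1; congr (_%:M).
  apply/eqP; rewrite -subr_eq0; have /eqP := ak1; rewrite -subr_eq0.
  have pk : [pchar F].-nat (p ^ k)%N by rewrite pnatX pnatE ?pF // (pcharf_prime pF).
  have -> : a ^+ (p ^ k) - 1 = (a - 1) ^+ (p ^ k).
    have /eqP := exprDn_pchar (a - 1) 1 pk.
    by rewrite subrK expr1n -subr_eq => /eqP.
  by rewrite expf_eq0 => /andP[_].
- move=> n X U modU _ _ sub fact.
  by rewrite -!(mxtrace_sub_fact_mod modU) ?mem_cycle ?cycle_id // sub fact.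
Qed.

(** The matrices [X m] span the full matrix algebra, so the [X (m * h)] do too, and some matrix has
    nonzero trace. *)
Lemma irr_trace_coset_neq0 K M (sMK : M \subset K) n (X : rep K n) h :
    mx_irreducible (subg_repr X sMK) -> h \in K ->
  exists2 m, m \in M & \tr (X (m * h)%g) != 0.
Proof.
move=> irrX Kh; have [n_gt0 _] := (mx_irrP _).1 irrX.
apply: NNPP => no_m.
have tr0 m : m \in M -> \tr (X (m * h)%g) = 0.
  by move=> Mm; apply/eqP/negPn/negP=> nz; apply: no_m; exists m.
pose i0 := Ordinal n_gt0; pose A : 'M[F]_n := delta_mx i0 i0 *m X h^-1%g.
have := gring_liftK irrX A; move: (gring_lift _ _) => a defA.
have : \tr (A *m X h) = 1.
  rewrite /A -mulmxA -repr_mxM ?groupV // mulVg repr_mx1 mulmx1.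
  rewrite /mxtrace (bigD1 i0) //= mxE !eqxx.
  by rewrite big1 ?addr0 // => i /negPf; rewrite mxE => ->.
rewrite -defA /gring_mx /= mulmx_sum_row linear_sum mulmx_suml linear_sum big1.
  by move/esym/eqP; rewrite oner_eq0.
move=> i _ /=; rewrite linearZ /= rowK mxvecK -scalemxAl linearZ /=.
have Mi : enum_val i \in M := enum_valP i.
have Ki := subsetP sMK _ Mi; by rewrite -repr_mxM // tr0 // mulr0.
Qed.

Lemma conjg_mx_repr G n (X : rep G n) g :
  g \in 'N(G) -> mx_repr G (fun x => X (x ^ g^-1)%g).
Proof.
move=> nGg; split=> [|x y Gx Gy]; first by rewrite conj1g repr_mx1.
by rewrite conjMg repr_mxM ?memJ_norm ?groupV.
Qed.

Definition conjg_repr G n (X : rep G n) g (nGg : g \in 'N(G)) : rep G n :=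
  MxRepresentation (conjg_mx_repr X nGg).

Lemma conjg_repr_irr G n (X : rep G n) g (nGg : g \in 'N(G)) :
  mx_irreducible X -> mx_irreducible (conjg_repr X nGg).
Proof.
case/mx_irrP=> n_gt0 irrX; apply/mx_irrP; split=> // U modU; apply: irrX.
apply/mxmoduleP=> x Gx; have /mxmoduleP/(_ (x ^ g)%g) := modU.
by rewrite memJ_norm //= conjgK; apply.
Qed.

Lemma emb_conjg G N (nsNG : N <| G) n m (X : rep G n) (Y : rep N m) g
    (nNg : g \in 'N(N)) :
    g \in G -> emb Y (subg_repr X (normal_sub nsNG)) ->
  emb (conjg_repr Y nNg) (subg_repr X (normal_sub nsNG)).
Proof.
move=> Gg [B freeB homB]; exists (B *m X g).
  by rewrite /row_free mxrankMfree // repr_mx_free.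
move=> x Nx; rewrite /= mulmxA homB ?memJ_norm ?groupV //=.
have Gx := subsetP (normal_sub nsNG) x Nx.
rewrite -!mulmxA -!repr_mxM ?groupJ ?groupV //; congr (_ *m X _).
by rewrite conjgE invgK -!mulgA mulVg mulg1.
Qed.

(** By Clifford's theorem the restriction to [N] is a direct sum of simple submodules, translates of
    a single one; [e] is the number of summands. *)
Lemma homogeneous_trace G N (nsNG : N <| G) n (V : rep G n)
    (t : gT -> F) (d : nat) :
    mx_irreducible V ->
    (forall m (Y : rep N m), mx_irreducible Y ->
       emb Y (subg_repr V (normal_sub nsNG)) ->
       m = d /\ forall x, x \in N -> \tr (Y x) = t x) ->
  exists e, n = (e * d)%N /\ forall x, x \in N -> \tr (V x) = e%:R * t x.
Proof.
move=> irrV hom; have [n_gt0 _] := (mx_irrP _).1 irrV.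
have nz1 : (1%:M : 'M[F]_n) != 0 by rewrite -mxrank_eq0 mxrank1 -lt0n.
pose VN := subg_repr V (normal_sub nsNG).
have [M simM _] := dec_mxsimple_exists (mxmodule1 VN) nz1.
have [X sXG [def1 dx1]] := Clifford_basis irrV simM.
pose W x := if x \in X then (M *m V x)%MS else M.
have simW x : mxsimple VN (W x).
  by rewrite /W; case: ifP => // /(subsetP sXG) Gx; apply: Clifford_simple.
have homW x : \rank (W x) = d /\
    forall y, y \in N -> \tr (submod_repr (mxsimple_module (simW x)) y) = t y.
  by apply: hom (emb_submod _); apply/submod_mx_irr.
have WE x : x \in X -> W x = (M *m V x)%MS by rewrite /W => ->.
have def1' : (\sum_(x in X) W x :=: 1%:M)%MS by rewrite (eq_bigr _ WE).
have rk1 : n = (\sum_(x in X) \rank (W x))%N.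
  rewrite -{1}(mxrank1 F n) -def1 (mxdirectP dx1) /=.
  by apply: eq_bigr => x Xx; rewrite WE.
exists #|X|; split.
  by rewrite {1}rk1 -sum_nat_const; apply: eq_bigr => x _; have [] := homW x.
have dx1' : mxdirect (\sum_(x in X) W x).
  by apply/mxdirectP; rewrite /= def1' mxrank1.
move=> y Ny.
rewrite -[V y]/(VN y) -(mxtrace_submod1 (mxmodule1 VN) (eqmx_refl _) Ny).
rewrite -(mxtrace_dsum_mod (fun x => mxsimple_module (simW x)) _ def1') //.
rewrite (eq_bigr (fun=> t y)) => [|x Xx]; first by rewrite sumr_const mulr_natl.
by have [_ ->] := homW x.
Qed.

End Traces.

(** * Clifford theory through traces *)

Section Blocks.

Variables (F : closedFieldType) (gT : finGroupType).
Implicit Types G H K M N : {group gT}.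
Local Notation rep := (mx_representation F).

(** [P] is a projection onto [W]. It factors through a basis [B] of [W], and cyclicity of the trace
    turns [P *m A] into the action of [A] on [W]. *)
Lemma mxtrace_proj_stable n (W P A : 'M[F]_n) :
    (P <= W)%MS -> W *m P = W -> (W *m A <= W)%MS ->
  \tr (P *m A) = \tr (in_submod W (val_submod 1%:M *m A)).
Proof.
move=> sPW WP sWA; set B : 'M_(\rank W, n) := val_submod 1%:M.
have defP : P = in_submod W P *m B by rewrite -val_submodE in_submodK.
have sBW : (B <= W)%MS by rewrite val_submod1.
have BP : B *m P = B by have [D ->] := submxP sBW; rewrite -mulmxA WP.
have BD : B *m in_submod W P = 1%:M.
  by apply: val_submod_inj; rewrite val_submodE -mulmxA -defP BP.
have defBA : B *m A = in_submod W (B *m A) *m B.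
  by rewrite -val_submodE in_submodK // (submx_trans _ sWA) // submxMr.
by rewrite {1}defP -mulmxA mxtrace_mulC defBA -mulmxA BD mulmx1 -defBA.
Qed.

Variables (G N : {group gT}) (nsNG : N <| G) (n : nat) (V : rep G n).
Let VN := subg_repr V (normal_sub nsNG).
Hypothesis irrV : mx_irreducible V.
Variables (sH : socleType VN) (W : sH) (T : {group gT}).
Hypotheses (defT : T :=: rstabs V W) (sTG : T \subset G).
Hypothesis modW : mxmodule (subg_repr V sTG) W.

Local Notation "'Cl" := (Clifford_action sH) : action_scope.

(** This is the trace formula of an induced module, read off the blocks of imprimitivity: an element
    contributes to the trace only on the blocks that it fixes. *)
Lemma Clifford_block_trace x : x \in G ->
  \tr (V x) = \sum_(C in rcosets T G)
    (if (x ^ (repr C)^-1)%g \in T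
     then \tr (submod_repr modW (x ^ (repr C)^-1)%g) else 0).
Proof.
move=> Gx; set W' := (\sum_(Z : sH | Z != W) Z)%MS.
have dxW : (W :&: W' = 0)%MS.
  by have /mxdirect_sumsP/(_ W isT) := Socle_direct sH.
have [P [sPW WP ZP]] : exists P : 'M[F]_n,
    [/\ (P <= W)%MS, W *m P = W & forall Z : sH, Z != W -> Z *m P = 0].
  exists (proj_mx W W'); split=> [||Z nZW]; last 1 first.
  - by rewrite proj_mx_0 // (sumsmx_sup Z).
  - by rewrite -[proj_mx _ _]mul1mx proj_mx_sub.
  - by rewrite proj_mx_id.
have WV y : y \in G -> y \notin T -> W *m V y *m P = 0.
  move=> Gy; rewrite defT -Clifford_astab1 => nTy.
  have nWy : 'Cl%act W y != W.
    by apply: contra nTy => /eqP fixW; rewrite !inE Gy /= sub1set inE; apply/eqP.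
  have /submxP[D ->] : (W *m V y <= 'Cl%act W y)%MS.
    by rewrite (val_Clifford_act W Gy).
  by rewrite -mulmxA ZP ?mulmx0.
have trP y : y \in G ->
    \tr (P *m V y) = if y \in T then \tr (submod_repr modW y) else 0.
  move=> Gy; case: ifPn => Ty.
    by apply: mxtrace_proj_stable => //; apply: (mxmoduleP modW).
  have PP : P = P *m P by have /submxP[D {1 2}->] := sPW; rewrite -mulmxA WP.
  rewrite {1}PP -mulmxA mxtrace_mulC.
  by have /submxP[D {1}->] := sPW; rewrite -!mulmxA [W *m _]mulmxA WV ?mulmx0 ?linear0.
have Grepr C : C \in rcosets T G -> repr C \in G.
  case/rcosetsP=> y Gy ->; have /rcosetP[z Tz ->] := mem_repr_rcoset T y.
  by rewrite groupM // (subsetP sTG).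
(* The translates of [P] are the projections onto the homogeneous components, one for each coset of
   the stabiliser [T]. *)
have sumP : \sum_(C in rcosets T G) V (repr C)^-1%g *m P *m V (repr C) = 1%:M.
  set A := \sum_(_ in _) _.
  suff WA y : y \in G -> W *m V y *m A = W *m V y.
    have sum1 : (1%:M <= \sum_(Z : sH) Z)%MS.
      by rewrite -/(Socle sH) (Clifford_Socle1 irrV).
    have /sumsmx_subP sker : (forall Z : sH, true -> (Z <= kermx (A - 1%:M))%MS).
      move=> Z _; have [W0 _ defO] := imsetP (Clifford_atrans irrV sH).
      have /orbitP[g Gg defW] : W \in orbit (Clifford_action sH) G W0 by rewrite -defO inE.
      have /orbitP[h Gh defZ] : Z \in orbit (Clifford_action sH) G W0 by rewrite -defO inE.
      have /submxP[D defW0] : (W0 <= W *m V g^-1%g)%MS.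
        rewrite -[W0 : 'M_n](repr_mxK V Gg) submxMr // -(val_Clifford_act W0 Gg).
        by rewrite defW.
      rewrite -defZ (val_Clifford_act W0 Gh) defW0; apply/sub_kermxP.
      rewrite -(mulmxA D) -(mulmxA (W : 'M_n)) -repr_mxM ?groupV // -mulmxA.
      by rewrite mulmxBr mulmx1 WA ?subrr ?mulmx0 ?groupM ?groupV.
    have /sub_kermxP := submx_trans sum1 sker.
    by rewrite mul1mx => /eqP; rewrite subr_eq0 => /eqP.
  move=> Gy; rewrite mulmx_sumr (bigD1 (T :* y)) /=; last first.
    by apply/rcosetsP; exists y.
  rewrite big1 ?addr0 => [|C /andP[RC nCy]].
    have /rcosetP[z Tz defz] := mem_repr_rcoset T y.
    have Gz := subsetP sTG z Tz; rewrite defz invMg.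
    rewrite repr_mxM ?groupV // !mulmxA repr_mxK //.
    have sWz : (W *m V z^-1%g <= W)%MS by apply: (mxmoduleP modW); rewrite groupV.
    have /submxP[D defD] := sWz.
    rewrite defD -[D *m _ *m P]mulmxA WP -defD repr_mxM // mulmxA.
    by rewrite -{2}[z]invgK repr_mxK ?groupV.
  have Gr := Grepr _ RC.
  rewrite !mulmxA -(mulmxA W) -repr_mxM ?groupV // WV ?mul0mx //.
    by rewrite groupM ?groupV.
  apply: contra nCy => Tyr; apply/eqP.
  case/rcosetsP: RC Tyr => u Gu -> Tyr; rewrite -rcoset_repr.
  by apply/esym/rcoset_eqP; rewrite mem_rcoset.
rewrite -[V x]mul1mx -sumP mulmx_suml linear_sum /=; apply: eq_bigr => C RC.
have Gr := Grepr _ RC.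
have Gxr : (x ^ (repr C)^-1)%g \in G by rewrite groupJ ?groupV.
have Gr' : (repr C)^-1%g \in G by rewrite groupV.
have <- := trP _ Gxr; rewrite -!mulmxA mxtrace_mulC -!mulmxA.
have Gxr' : (x * (repr C)^-1)%g \in G by rewrite groupM.
by rewrite -(repr_mxM V Gx Gr') -(repr_mxM V Gr Gxr') conjgE invgK mulgA.
Qed.

Lemma Clifford_block_rank : n = (#|G : T| * \rank W)%N.
Proof.
rewrite -{1}(Clifford_rank_components irrV W); congr (_ * _)%N.
have [W0 _ defO] := imsetP (Clifford_atrans irrV sH).
have /orbitP[g Gg defW] : W \in orbit (Clifford_action sH) G W0 by rewrite -defO inE.
have <- : #|orbit (Clifford_action sH) G W| = #|G : T|.
  rewrite card_orbit_in // defT -Clifford_astab1 (setIidPr _) //.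
  by rewrite Clifford_astab1 -defT.
have -> : orbit (Clifford_action sH) G W = [set: sH]; last by rewrite cardsT.
rewrite defO -defW; apply/setP=> Z; apply/idP/idP.
  case/orbitP=> h Gh <-; apply/orbitP; exists (g * h)%g; first exact: groupM.
  exact: actMin.
case/orbitP=> h Gh <-; apply/orbitP; exists (g^-1 * h)%g.
  by rewrite groupM ?groupV.
by rewrite -actMin ?groupM ?groupV // mulKVg.
Qed.

End Blocks.

(** * Extensions across a cyclic quotient, up to a linear twist *)

Section Twist.

Variables (F : closedFieldType) (gT : finGroupType) (K M : {group gT}).
Local Notation rep := (mx_representation F).
Hypothesis nsMK : M <| K.
Variables (n m : nat) (X : rep K n) (U : rep K m).
Let sMK := normal_sub nsMK.
Variables (g : gT) (r : nat) (z : F).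
Hypotheses (Kg : g \in K) (Mgr : (g ^+ r)%g \in M).
Hypothesis prim_z : r.-primitive_root z.
Hypothesis defK : forall x, x \in K -> exists a i, a \in M /\ x = (a * g ^+ i)%g.

(* Since g^r lies in M, conjugation by g acts on Hom_M(X, U) with order dividing
   r; an eigenvector is an isomorphism from a twist of X to U. *)
Lemma twist_trace :
    mx_irreducible (subg_repr X sMK) -> mx_irreducible U ->
    emb (subg_repr X sMK) (subg_repr U sMK) ->
  n = m /\ exists j : nat, forall a i, a \in M ->
     \tr (U (a * g ^+ i)%g) = (z ^+ j) ^+ i * \tr (X (a * g ^+ i)%g).
Proof.
move=> irrX irrU [B freeB homB].
have [n_gt0 _] := (mx_irrP _).1 irrX.
have r_gt0 := prim_order_gt0 prim_z.
have Kgi i : (g ^+ i)%g \in K by rewrite groupX.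
have Kgi' i : (g ^+ i)^-1%g \in K by rewrite groupV.
have nMg i : (g ^+ i)%g \in 'N(M) by rewrite (subsetP (normal_norm nsMK)).
pose C i := X (g ^+ i)^-1%g *m B *m U (g ^+ i)%g.
have homC i x : x \in M -> X x *m C i = C i *m U x.
  move=> Mx; have Kx := subsetP sMK x Mx.
  have Mxg : (x ^ (g ^+ i)^-1)%g \in M by rewrite memJ_norm ?groupV.
  have Kxg := subsetP sMK _ Mxg.
  have XE : X x *m X (g ^+ i)^-1%g = X (g ^+ i)^-1%g *m X (x ^ (g ^+ i)^-1)%g.
    by rewrite -!repr_mxM // -conjgC.
  have UE : U (g ^+ i)%g *m U x = U (x ^ (g ^+ i)^-1)%g *m U (g ^+ i)%g.
    by rewrite -!repr_mxM // -conjgCV.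
  rewrite /C !mulmxA XE -(mulmxA _ (X _) B) (homB _ Mxg : X _ *m B = B *m U _).
  by rewrite -!mulmxA UE.
have CS i : X g *m C i.+1 = C i *m U g.
  rewrite /C !mulmxA -repr_mxM // expgSr invMg mulgA mulgV mul1g.
  by rewrite repr_mxM // mulmxA.
have C0 : C 0%N = B by rewrite /C expg0 invg1 !repr_mx1 mulmx1 mul1mx.
(* Periodicity: [B] already commutes with the action of [g ^+ r], an element of [M]. *)
have Cr : C r = B.
  have Mgr' : (g ^+ r)^-1%g \in M by rewrite groupV.
  rewrite /C homB //= -mulmxA -repr_mxM // mulVg repr_mx1 mulmx1 //.
(* A discrete Fourier transform: [A j] is the eigencomponent of [B] for conjugation by [g]. These
   components sum to [r%:R *: B], nonzero because a primitive [r]-th root of unity exists in [F]. *)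
pose A j := \sum_(i < r) (z ^- j) ^+ i *: C i.
have [j nzA] : exists j, A j != 0.
  have sumA : \sum_(j < r) A j = r%:R *: B.
    rewrite exchange_big (bigD1 (Ordinal r_gt0)) //= [X in _ + X]big1 ?addr0 => [|i ni0].
      rewrite -scaler_suml C0 (eq_bigr (fun=> 1)) => [|k _]; last by rewrite expr0.
      by rewrite sumr_const card_ord.
    rewrite -scaler_suml.
    have nz1 : (z ^- i) != 1.
      rewrite invr_eq1 -(prim_order_dvd prim_z).
      by rewrite gtnNdvd // lt0n.
    have -> : \sum_(k < r) (z ^- k) ^+ i = \sum_(k < r) (z ^- i) ^+ k.
      by apply: eq_bigr => k _; rewrite !exprVn -!exprM mulnC.
    apply/eqP; rewrite scaler_eq0; apply/orP; left.
    have : (z ^- i - 1) * (\sum_(k < r) (z ^- i) ^+ k) == 0.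
      by rewrite -subrX1 exprVn -exprM mulnC exprM (prim_expr_order prim_z) expr1n invr1 subrr.
    by rewrite mulf_eq0 subr_eq0 (negPf nz1).
  apply: NNPP => noA; have : r%:R *: B != 0.
    rewrite scaler_eq0 negb_or (prim_root_natf_neq0 prim_z) /=.
    by rewrite -mxrank_eq0 (eqP freeB) -lt0n.
  rewrite -sumA big1 ?eqxx // => j _; apply/eqP/negPn/negP=> nzA.
  by apply: noA; exists j.
have homA x : x \in M -> X x *m A j = A j *m U x.
  move=> Mx; rewrite /A mulmx_sumr mulmx_suml; apply: eq_bigr => i _.
  by rewrite -scalemxAr -scalemxAl homC.
have nzz : z != 0 by rewrite (prim_root_eq0 prim_z) -lt0n.
have gA : A j *m U g = z ^+ j *: (X g *m A j).
  pose h i := (z ^- j) ^+ i *: (X g *m C i).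
  have h_r : h r = h 0%N.
    rewrite /h Cr C0 expr0 exprVn -exprM mulnC exprM (prim_expr_order prim_z).
    by rewrite expr1n invr1.
  have sum_h : \sum_(i < r) h i.+1 = \sum_(i < r) h i.
    apply: (addrI (h 0%N)); rewrite addrC -[in RHS]h_r [RHS]addrC.
    by rewrite -(big_ord_recr r (fun i => h i)) big_ord_recl addrC.
  rewrite /A mulmx_suml mulmx_sumr.
  rewrite [X in _ *: X](eq_bigr (fun i : 'I_r => h i)) => [|i _]; last first.
    by rewrite -scalemxAr.
  rewrite -sum_h scaler_sumr; apply: eq_bigr => i _.
  rewrite /h CS -scalemxAl scalerA exprS exprVn mulrA mulfV ?mul1r //.
  by rewrite expf_neq0.
have giA i x : x \in M ->
    A j *m U (x * g ^+ i)%g = (z ^+ j) ^+ i *: (X (x * g ^+ i)%g *m A j).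
  move=> Mx; have Kx := subsetP sMK _ Mx; elim: i => [|i IHi].
    by rewrite expg0 mulg1 expr0 scale1r homA.
  have Kxg : (x * g ^+ i)%g \in K by rewrite groupM.
  rewrite expgSr mulgA (repr_mxM U Kxg Kg) (repr_mxM X Kxg Kg).
  rewrite mulmxA IHi -scalemxAl -(mulmxA _ (A j)) gA.
  by rewrite -scalemxAr scalerA mulmxA exprSr.
have freeA : row_free (A j).
  exact: (hom_irr_row_free (Y := subg_repr U sMK) irrX nzA homA).
have modA : mxmodule U (A j).
  apply/mxmoduleP=> x /defK[a [i [Ma ->]]].
  by rewrite giA // scalemx_sub // submxMl.
have fullA : row_full (A j).
  have /mx_irrP[_ /(_ <<A j>>%MS)] := irrU.
  rewrite (eqmx_module _ (genmxE _)) (eqmx_eq0 (genmxE _)) => /(_ modA nzA).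
  by rewrite /row_full genmxE.
have eq_nm : n = m.
  by apply: etrans (eqP fullA); apply/esym/eqP.
split=> //; exists j => a i Ma; move: (A j) freeA (giA i a Ma).
move: (X _) (U _) => Y; move: Y; rewrite eq_nm => Y Z D freeD homD.
have uD : D \in unitmx by rewrite -row_free_unit.
have -> : Z = invmx D *m ((z ^+ j) ^+ i *: (Y *m D)) by rewrite -homD mulKmx.
by rewrite -scalemxAr linearZ /= mxtrace_mulC mulmxK.
Qed.

End Twist.

(** * Reduction of complex representations modulo a maximal ideal *)

Lemma Aint_integralOver (x : algC) :
  x \in Aint <-> integralOver (intr : int -> algC) x.
Proof.
split=> [Ax | [p mon_p root_p]]; last first.
  apply: root_monic_Aint root_p _ _; first exact: monic_map.
  by apply/(polyOverP)=> i; rewrite coef_map /= intr_int.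
have /floorpP[q defq] := (Ax : minCpoly x \is a polyOver Num.int).
exists q; last by rewrite -defq root_minCpoly.
have := minCpoly_monic x; rewrite defq !monicE lead_coef_map_inj //.
  by rewrite -[1]/(1%:~R) eqr_int.
exact: intr_inj.
Qed.

Lemma Aint_integrally_closed (p : {poly algC}) y :
  p \is monic -> root p y -> p \is a polyOver Aint -> y \in Aint.
Proof.
move=> mon_p root_p Ap; apply/Aint_integralOver.
apply: (integral_root_monic mon_p root_p) => c p_c.
apply/Aint_integralOver; have /(nthP 0)[i _ <-] := p_c.
exact: (polyOverP Ap).
Qed.

Lemma algInt_val0 : algInt_val 0 = 0. Proof. exact: (rmorph0 val). Qed.

Lemma algInt_val1 : algInt_val 1 = 1. Proof. exact: (rmorph1 val). Qed.

Lemma algInt_valD a b : algInt_val (a + b) = algInt_val a + algInt_val b.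
Proof. exact: (rmorphD val). Qed.

Lemma algInt_valM a b : algInt_val (a * b) = algInt_val a * algInt_val b.
Proof. exact: (rmorphM val). Qed.

Lemma algInt_val_int m : algInt_val m%:~R = m%:~R.
Proof. exact: (rmorph_int val). Qed.

Section Reduction.

Variables (F : closedFieldType) (red : {rmorphism algInt -> F}).

(* The graph of the extension of red to the localization of algInt at its
   kernel. *)
Definition reduces (c : algC) (v : F) : Prop :=
  exists a s : algInt,
    [/\ red s != 0, algInt_val s * c = algInt_val a & v = red a / red s].

Definition local_int (c : algC) : Prop := exists v, reduces c v.

Lemma reducesD c d v w : reduces c v -> reduces d w -> reduces (c + d) (v + w).
Proof.
case=> a [s [nzs defa ->]] [b [t [nzt defb ->]]].
exists (t * a + s * b), (s * t); split.
- by rewrite rmorphM mulf_neq0.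
- by rewrite algInt_valD !algInt_valM -defa -defb; ring.
by rewrite rmorphD !rmorphM addf_div // [red t * _]mulrC [red s * red b]mulrC.
Qed.

Lemma reducesM c d v w : reduces c v -> reduces d w -> reduces (c * d) (v * w).
Proof.
case=> a [s [nzs defa ->]] [b [t [nzt defb ->]]].
exists (a * b), (s * t); split.
- by rewrite rmorphM mulf_neq0.
- by rewrite !algInt_valM -defa -defb; ring.
by rewrite !rmorphM mulf_div.
Qed.

Lemma reduces_val (a : algInt) : reduces (algInt_val a) (red a).
Proof. by exists a, 1; rewrite rmorph1 oner_neq0 algInt_val1 mul1r divr1. Qed.

Lemma reduces0 : reduces 0 0.
Proof. by have := reduces_val 0; rewrite rmorph0 algInt_val0. Qed.

Lemma reduces1 : reduces 1 1.
Proof. by have := reduces_val 1; rewrite rmorph1 algInt_val1. Qed.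

Lemma reducesV c v : v != 0 -> reduces c v -> reduces c^-1 v^-1.
Proof.
move=> nzv [a [s [nzs defa defv]]].
have nza : red a != 0 by apply: contraNneq nzv => a0; rewrite defv a0 mul0r.
have nzc : c != 0.
  apply: contraNneq nza => c0; suff -> : a = 0 by rewrite rmorph0.
  by apply: val_inj; rewrite /= -defa c0 mulr0.
exists s, a; split=> //; last by rewrite defv invf_div.
by rewrite -defa mulfK.
Qed.

Lemma reduces_inj c v w : reduces c v -> reduces c w -> v = w.
Proof.
case=> a [s [nzs defa ->]] [b [t [nzt defb ->]]].
apply/eqP; rewrite eqr_div // -!rmorphM; apply/eqP; congr (red _); apply: val_inj.
by rewrite -[LHS]/(algInt_val (a * t)) -[RHS]/(algInt_val (b * s)) !algInt_valM -defa -defb; ring.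
Qed.

Lemma local_int_denominator (I : finType) (f : I -> algC) :
  (forall i, local_int (f i)) ->
  exists2 s : algInt, red s != 0 & forall i, algInt_val s * f i \in Aint.
Proof.
move=> locf.
suff [s nzs Asf] : exists2 s : algInt, red s != 0 &
    forall i, i \in enum I -> algInt_val s * f i \in Aint.
  by exists s => // i; rewrite Asf ?mem_enum.
elim: (enum I) => [|i r [s nzs Asf]]; first by exists 1; rewrite ?rmorph1 ?oner_neq0.
have [_ [a [t [nzt defa _]]]] := locf i.
exists (t * s) => [|j]; first by rewrite rmorphM mulf_neq0.
rewrite inE algInt_valM => /predU1P[-> | /Asf].
  by rewrite mulrAC defa rpredM // (valP a, valP s).
by rewrite -mulrA => Asj; rewrite rpredM ?(valP t).
Qed.

(** Integral closedness of the local ring. If [S] is a common denominator of the coefficients with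
    nonzero reduction, [S * y] is a root of a monic polynomial over the algebraic integers, hence
    one itself. *)
Lemma local_int_root m (c : nat -> algC) y :
    (forall i, (i < m)%N -> local_int (c i)) ->
    y ^+ m + \sum_(i < m) c i * y ^+ i = 0 ->
  local_int y.
Proof.
move=> locc rooty.
have [s nzs As] := local_int_denominator (fun i : 'I_m => locc i (ltn_ord i)).
pose S := algInt_val s; have AS : S \in Aint := valP s.
pose p := 'X^m + \sum_(i < m) (S ^+ (m - i) * c i) *: 'X^i.
have lt_size : (size (\sum_(i < m) (S ^+ (m - i) * c i) *: 'X^i)%R < m.+1)%N.
  apply: leq_ltn_trans (size_sum _ _ _) _; rewrite ltnS.
  apply/bigmax_leqP => i _; apply: leq_trans (size_scale_leq _ _) _.
  by rewrite size_polyXn.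
have mon_p : p \is monic.
  by rewrite monicE lead_coefDl ?lead_coefXn // size_polyXn.
suff : S * y \in Aint.
  move=> ASy; exists (red (AlgInt ASy) / red s); exists (AlgInt ASy), s; split=> //.
apply: (Aint_integrally_closed mon_p).
  rewrite /root hornerD hornerXn horner_sum.
  suff -> : (S * y) ^+ m + \sum_(i < m) ((S ^+ (m - i) * c i) *: 'X^i).[S * y]
         = S ^+ m * (y ^+ m + \sum_(i < m) c i * y ^+ i) by rewrite rooty mulr0.
  rewrite mulrDr mulr_sumr exprMn; congr (_ + _); apply: eq_bigr => i _.
  have -> : S ^+ m = S ^+ (m - i) * S ^+ i by rewrite -exprD subnK // ltnW.
  by rewrite hornerZ hornerXn exprMn; ring.
apply: rpredD; first by rewrite rpredX // polyOverX.
apply: rpred_sum => i _; apply: polyOverZ; last by rewrite rpredX // polyOverX.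
have -> : (m - i = (m - i).-1.+1)%N by rewrite prednK // subn_gt0.
by rewrite exprSr -mulrA rpredM ?rpredX ?As.
Qed.

(* If x or 1/x is not yet seen to be local, the leading coefficient a of the
   relation reduces to 0; then b = a x is local and, unless b is a unit, it can
   be absorbed into the next coefficient. *)
Lemma local_int_valuation_ind n (a : nat -> algC) (w : nat -> F) x :
    (forall i, reduces (a i) (w i)) ->
    (exists2 i, (i <= n)%N & w i != 0) ->
    \sum_(i < n.+1) a i * x ^+ i = 0 ->
  local_int x \/ local_int x^-1.
Proof.
elim: n a w => [|n IHn] a w red_a [i0 le_i0n nzw] rel.
  move: rel; rewrite big_ord1 expr0 mulr1 => a0; move: le_i0n nzw.
  rewrite leqn0 => /eqP->; have := red_a 0%N; rewrite a0 => red0.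
  by rewrite (reduces_inj red0 reduces0) eqxx.
have [wn0 | nzwn] := eqVneq (w n.+1) 0; last first.
  left; apply: (@local_int_root n.+1 (fun i => a i / a n.+1)) => [i _|].
    by exists (w i / w n.+1); apply: reducesM => //; apply: reducesV.
  have nzan : a n.+1 != 0.
    apply: contraNneq nzwn => an0; have := red_a n.+1; rewrite an0 => red0.
    by rewrite (reduces_inj red0 reduces0).
  apply: (mulfI nzan); rewrite mulr0 -[RHS]rel [RHS]big_ord_recr /= [RHS]addrC mulrDr.
  congr (_ + _); rewrite mulr_sumr; apply: eq_bigr => i _.
  by rewrite mulrA mulrCA mulfV ?mulr1.
pose b := a n.+1 * x.
have [v red_b] : local_int b.
  apply: (@local_int_root n.+1 (fun i => a i * a n.+1 ^+ (n - i))) => [i _|].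
    exists (w i * w n.+1 ^+ (n - i)); apply: reducesM => //.
    elim: (n - i)%N => [|k IHk]; first exact: reduces1.
    by rewrite !exprS; apply: reducesM.
  suff -> : b ^+ n.+1 + \sum_(i < n.+1) a i * a n.+1 ^+ (n - i) * b ^+ i =
            a n.+1 ^+ n * \sum_(i < n.+2) a i * x ^+ i by rewrite rel mulr0.
  rewrite [in RHS]big_ord_recr /= mulrDr [RHS]addrC.
  congr (_ + _); first by rewrite /b exprMn exprS; ring.
  rewrite mulr_sumr; apply: eq_bigr => i _; rewrite /b exprMn.
  have -> : a n.+1 ^+ n = a n.+1 ^+ (n - i) * a n.+1 ^+ i.
    by rewrite -exprD subnK // -ltnS.
  by ring.
have [v0 | nzv] := eqVneq v 0; last first.
  right; have nzb : b != 0.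
    apply: contraNneq nzv => b0; move: red_b; rewrite b0 => red0.
    by rewrite (reduces_inj red0 reduces0).
  have [nzan nzx] : a n.+1 != 0 /\ x != 0.
    by move: nzb; rewrite /b mulf_eq0 negb_or => /andP[].
  have -> : x^-1 = a n.+1 * b^-1 by rewrite /b invfM mulrA mulfV ?mul1r.
  by exists (w n.+1 * v^-1); apply: reducesM => //; apply: reducesV.
pose a' i := if i == n then a n + b else a i.
apply: (IHn a' w) => [i||].
- rewrite /a'; case: eqP => [-> | _] //.
  by rewrite -[w n]addr0 -v0; apply: reducesD.
- exists i0 => //; move: le_i0n; rewrite leq_eqVlt => /predU1P[def_i0 | //].
  by rewrite def_i0 wn0 eqxx in nzw.
rewrite -[RHS]rel [RHS]big_ord_recr [RHS]/= !big_ord_recr /= /a' eqxx.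
rewrite -addrA; congr (_ + _).
  by apply: eq_bigr => i _; rewrite ltn_eqF.
by rewrite /b exprS; ring.
Qed.

Variable p : nat.
Hypothesis pF : p \in [pchar F].

Lemma reduces_int (m : int) : reduces m%:~R m%:~R.
Proof.
by have := reduces_val m%:~R; rewrite rmorph_int algInt_val_int.
Qed.

(** The localization is a valuation ring: [x] is a root of a primitive integer polynomial, and
    primitivity yields a coefficient prime to [p], which survives in [F]. *)
Lemma local_int_valuation (x : algC) : local_int x \/ local_int x^-1.
Proof.
have [q prim_q [nzq root_q]] : exists2 q : {poly int}, zprimitive q = q &
    q != 0 /\ root (map_poly (intr : int -> algC) q) x.
  have [r [defr mon_r] _] := minCpolyP x.
  have [q [a nza defq]] := rat_poly_scale r.
  have nzq : q != 0.
    apply: contraTneq mon_r => q0; rewrite defq q0 map_poly0 scaler0.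
    by rewrite monicE lead_coef0 eq_sym oner_eq0.
  exists (zprimitive q); first exact: zprimitive_id.
  rewrite zprimitive_eq0; split=> //.
  have := root_minCpoly x; rewrite defr defq {1}(zpolyEprim q).
  rewrite map_polyZ (map_polyZ intr) /= map_polyZ /=.
  rewrite -map_poly_comp rootZ ?rootZ.
  - rewrite (@eq_map_poly _ _ _ (intr : int -> algC)) // => c /=; exact: ratr_int.
  - by rewrite fmorph_eq0 intr_eq0 zcontents_eq0.
  by rewrite fmorph_eq0 invr_eq0 intr_eq0.
apply: (local_int_valuation_ind (n := (size q).-1) (fun i => reduces_int q`_i)).
  have pr_p := pcharf_prime pF.
  have : ~~ (p%:Z %| zcontents q)%Z.
    by rewrite -prim_q zcontents_primitive nzq /= dvdz1 /= neq_ltn (prime_gt1 pr_p) orbT.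
  rewrite dvdz_contents => /polyOverP nall; apply: NNPP => no_i; apply: nall => i.
  have [lt_i | ge_i] := ltnP i (size q); last by rewrite nth_default ?dvdz0.
  apply/negPn/negP=> ndiv; apply: no_i; exists i.
    by rewrite -ltnS prednK ?size_poly_gt0.
  by rewrite -(dvdz_pcharf pF).
have := rootP root_q; rewrite horner_coef size_map_inj_poly ?rmorph0 //; last exact: intr_inj.
rewrite prednK ?size_poly_gt0 // => root0; rewrite -[RHS]root0; apply: eq_bigr => i _.
by rewrite coef_map.
Qed.

Lemma local_int_total (x y : algC) :
  x != 0 -> y != 0 -> local_int (x / y) \/ local_int (y / x).
Proof.
by move=> nzx nzy; have := local_int_valuation (x / y); rewrite invf_div.
Qed.

(** Divisibility in a valuation ring is a total preorder, so a finite family has a member dividing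
    all the others. *)
Lemma local_int_max (I : finType) (f : I -> algC) i0 : f i0 != 0 ->
  exists2 j, f j != 0 & forall i, local_int (f i / f j).
Proof.
move=> nzi0.
suff [j nzj maxj] : exists2 j, f j != 0 &
    forall i, i \in enum I -> local_int (f i / f j).
  by exists j => // i; apply: maxj; rewrite mem_enum.
elim: (enum I) => [|i s [j nzj maxj]]; first by exists i0.
have [fi0 | nzi] := eqVneq (f i) 0.
  exists j => // k; rewrite inE => /predU1P[-> | /maxj //].
  by rewrite fi0 mul0r; exists 0; apply: reduces0.
have [le_ij | [v le_ji]] := local_int_total nzi nzj.
  by exists j => // k; rewrite inE => /predU1P[-> | /maxj].
exists i => // k; rewrite inE => /predU1P[-> | /maxj [w le_kj]].
  by rewrite divff //; exists 1; apply: reduces1.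
exists (w * v); have -> : f k / f i = f k / f j * (f j / f i).
  by rewrite mulrA mulfVK.
exact: reducesM.
Qed.

(** Cramer's rule for row vectors. *)
Lemma det_row_replace (R : fieldType) n (P : 'M[R]_n) (u : 'rV_n) j :
  P \in unitmx ->
  (u *m invmx P) 0 j =
    \det (\matrix_k (if k == j then u else row k P)) / \det P.
Proof.
move=> uP; rewrite /invmx uP -scalemxAr mxE mulrC; congr (_ / _).
set Q := \matrix_k _; rewrite mxE (expand_det_row Q j); apply: eq_bigr => k _.
rewrite mxE /Q mxE eqxx; congr (_ * _); rewrite /cofactor; congr (_ * \det _).
apply/matrixP=> a b; rewrite !mxE [lift _ _ == _]eq_sym (negPf (neq_lift j a)).
by rewrite mxE.
Qed.

(* The lattice generated by the rows of all the rG x is free over the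
   localization: among all choices of n of these rows, one with maximal
   determinant is a basis by Cramer's rule. *)
Lemma local_int_repr (gT : finGroupType) (G : {group gT}) n
    (rG : mx_representation algC G n) :
  exists2 P : 'M[algC]_n, P \in unitmx &
    forall x, x \in G -> forall i j, local_int ((P *m rG x *m invmx P) i j).
Proof.
pose I := ('I_#|G| * 'I_n)%type.
pose r (e : I) := row e.2 (rG (enum_val e.1)).
pose P (f : {ffun 'I_n -> I}) : 'M[algC]_n := \matrix_j r (f j).
pose k1 := enum_rank_in (group1 G) 1%g.
have nz1 : \det (P [ffun j => (k1, j)]) != 0.
  suff -> : P [ffun j => (k1, j)] = 1%:M by rewrite det1 oner_neq0.
  apply/row_matrixP=> j; rewrite rowK /r ffunE /= enum_rankK_in ?group1 //.
  by rewrite repr_mx1.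
have [f nzf maxf] := local_int_max (f := fun f => \det (P f)) nz1.
have uP : P f \in unitmx by rewrite unitmxE unitfE.
exists (P f) => // x Gx i j.
(* The family [r] is stable under right multiplication by [G], so each row of [P f *m rG x] is again
   a member of it. *)
have [e ->] : exists e, (P f *m rG x *m invmx (P f)) i j = (r e *m invmx (P f)) 0 j.
  have [k defk] : exists k : 'I_#|G|, enum_val k = (enum_val (f i).1 * x)%g.
    have Gy : (enum_val (f i).1 * x)%g \in G by rewrite groupM ?enum_valP.
    by exists (enum_rank_in Gy (enum_val (f i).1 * x)%g); rewrite enum_rankK_in.
  exists (k, (f i).2).
  rewrite /r /= defk repr_mxM ?enum_valP // row_mul -[row _ _]/(r (f i)).
  have -> : r (f i) = row i (P f) by rewrite rowK.
  by rewrite -!row_mul [RHS]mxE.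
rewrite det_row_replace //; have := maxf (finfun (fun k => if k == j then e else f k)).
congr (local_int (\det _ / _)); apply/row_matrixP=> k; rewrite !rowK ffunE.
by case: eqP => // _; rewrite rowK.
Qed.

End Reduction.

Section ScaledCharPoly.

(* A basis of a lattice makes the matrices of a representation local but not
   integral; after clearing a common denominator s only B = s A is over algInt,
   and this is s ^ n times the characteristic polynomial of A. *)
Definition scaled_char_poly (R : comNzRingType) n (s : R) (B : 'M[R]_n) :=
  \det ((s%:P * 'X)%:M - map_mx polyC B).

Lemma map_scaled_char_poly (R R' : comNzRingType) (f : {rmorphism R -> R'}) n
    (s : R) (B : 'M[R]_n) :
  map_poly f (scaled_char_poly s B) = scaled_char_poly (f s) (map_mx f B).
Proof.
rewrite /scaled_char_poly -det_map_mx; congr (\det _); apply/matrixP=> i j.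
by rewrite !mxE rmorphB /= rmorphMn /= rmorphM /= map_polyX !map_polyC.
Qed.

Lemma scaled_char_polyE (R : comNzRingType) n (s : R) (A : 'M[R]_n) :
  scaled_char_poly s (s *: A) = s%:P ^+ n * char_poly A.
Proof.
rewrite /char_poly -detZ; congr (\det _); apply/matrixP=> i j.
by rewrite !mxE mulrBr polyCM mulrnAr.
Qed.

Lemma char_poly_conj (R : fieldType) n (Q A : 'M[R]_n) :
  Q \in unitmx -> char_poly (Q *m A *m invmx Q) = char_poly A.
Proof.
move=> uQ; pose q := map_mx polyC Q; pose q' := map_mx polyC (invmx Q).
have qq' : q *m q' = 1%:M by rewrite -map_mxM mulmxV // map_mx1.
have E : char_poly_mx (Q *m A *m invmx Q) = q *m char_poly_mx A *m q'.
  rewrite /char_poly_mx mulmxBr mulmxBl !map_mxM -/q -/q'.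
  by rewrite mul_mx_scalar -scalemxAl qq' scalemx1.
by rewrite /char_poly E !det_mulmx mulrAC -det_mulmx qq' det1 mul1r.
Qed.

End ScaledCharPoly.

(** * Reduction of complex characters to representations over F *)

Section ReductionModP.

Variables (F : closedFieldType) (red : {rmorphism algInt -> F}) (p : nat).
Hypothesis pF : p \in [pchar F].

(* Junk value red 0 = 0 outside of Aint. *)
Definition redC (y : algC) : F := red (insubd 0 y).

Lemma redC_val (a : algInt) : redC (algInt_val a) = red a.
Proof. by rewrite /redC valKd. Qed.

Lemma redCD x y : x \in Aint -> y \in Aint -> redC (x + y) = redC x + redC y.
Proof.
move=> Ax Ay; rewrite -[x]/(algInt_val (AlgInt Ax)) -[y]/(algInt_val (AlgInt Ay)).
by rewrite -algInt_valD !redC_val rmorphD.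
Qed.

Lemma redCM x y : x \in Aint -> y \in Aint -> redC (x * y) = redC x * redC y.
Proof.
move=> Ax Ay; rewrite -[x]/(algInt_val (AlgInt Ax)) -[y]/(algInt_val (AlgInt Ay)).
by rewrite -algInt_valM !redC_val rmorphM.
Qed.

Lemma redC0 : redC 0 = 0.
Proof. by rewrite -algInt_val0 redC_val rmorph0. Qed.

Lemma redC1 : redC 1 = 1.
Proof. by rewrite -algInt_val1 redC_val rmorph1. Qed.

Lemma redC_sum (I : Type) (r : seq I) (P : pred I) (f : I -> algC) :
    (forall i, P i -> f i \in Aint) ->
  redC (\sum_(i <- r | P i) f i) = \sum_(i <- r | P i) redC (f i).
Proof.
move=> Af; suff [] : \sum_(i <- r | P i) f i \in Aint /\
  redC (\sum_(i <- r | P i) f i) = \sum_(i <- r | P i) redC (f i) by [].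
elim/big_rec2: _ => [|i y x Pi [Ax <-]]; first by rewrite redC0.
by rewrite rpredD ?Af // redCD ?Af.
Qed.

Lemma redCX x n : x \in Aint -> redC (x ^+ n) = redC x ^+ n.
Proof.
move=> Ax; elim: n => [|n IHn]; first by rewrite !expr0 redC1.
by rewrite !exprS redCM ?rpredX // IHn.
Qed.

(** The eigenvalue clauses yield Brauer characters and the trace clause feeds the independence of
    traces. Both range over all of [G], so the roots in [s] may have order divisible by [p]. *)
Definition affords_reduction gT (G : {group gT}) n
    (X : mx_representation F G n) (chi : 'CF(G)) : Prop :=
  chi 1%g = n%:R /\ forall x, x \in G -> exists s : seq algInt,
    [/\ {in s, forall z, z ^+ #[x] = 1},
        char_poly (X x) = \prod_(z <- s) ('X - (red z)%:P),
        chi x = \sum_(z <- s) (z : algC)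
      & \tr (X x) = redC (chi x)].

(** In a basis of an invariant lattice the matrices [Y x] are local; with a common denominator [S]
    the matrices [Z x] = [S] [Y x] are integral, and dividing their reduction by [red S] gives a
    representation. *)
Lemma exists_reduction gT (G : {group gT}) (chi : 'CF(G)) :
    chi \is a character ->
  exists n, exists X : mx_representation F G n, affords_reduction X chi.
Proof.
case/char_reprP=> -[n rG] ->; exists n.
have [P uP locP] := local_int_repr red pF rG.
pose Y x := P *m rG x *m invmx P.
(* Sending the elements outside [G] to 1 makes the entries a family over a finite type, as
   [local_int_denominator] expects. *)
pose x0 : gT -> gT := fun x => if x \in G then x else 1%g.
have Gx0 x : x0 x \in G by rewrite /x0; case: ifP.
have x0E x : x \in G -> x0 x = x by rewrite /x0 => ->.
have [S nzS AS] := local_int_denominator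
  (fun e : gT * ('I_n * 'I_n) => locP _ (Gx0 e.1) e.2.1 e.2.2).
pose Z x : 'M[algInt]_n := \matrix_(i, j) insubd 0 (algInt_val S * Y x i j).
have valZ x : x \in G -> map_mx algInt_val (Z x) = algInt_val S *: Y x.
  move=> Gx; apply/matrixP=> i j; rewrite mxE [Z x i j]mxE [RHS]mxE insubdK //.
  by have := AS (x, (i, j)); rewrite /= x0E.
have val_inj_mx (A B : 'M[algInt]_n) :
    map_mx algInt_val A = map_mx algInt_val B -> A = B.
  move=> eqAB; apply/matrixP=> i j; apply: val_inj => /=.
  by have /matrixP/(_ i j) := eqAB; rewrite !mxE.
have Y1 : Y 1%g = 1%:M by rewrite /Y repr_mx1 mulmx1 mulmxV.
have YM x y : x \in G -> y \in G -> Y (x * y)%g = Y x *m Y y.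
  by move=> Gx Gy; rewrite /Y repr_mxM // !mulmxA mulmxKV.
pose X x := (red S)^-1 *: map_mx red (Z x).
have Xrepr : mx_repr G X.
  split=> [|x y Gx Gy].
    rewrite /X; have -> : Z 1%g = S%:M.
      apply: val_inj_mx; rewrite valZ // Y1 scalemx1.
      by apply/matrixP=> i j; rewrite !mxE; case: eqP; rewrite ?mulr1n ?mulr0n ?algInt_val0.
    by rewrite map_scalar_mx -mul_scalar_mx -scalar_mxM mulVf.
  have ZM : S *: Z (x * y)%g = Z x *m Z y.
    apply: val_inj_mx.
    have -> : map_mx algInt_val (S *: Z (x * y)%g) =
              algInt_val S *: map_mx algInt_val (Z (x * y)%g).
      by apply/matrixP=> i j; rewrite !mxE algInt_valM.
    have -> : map_mx algInt_val (Z x *m Z y) =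
              map_mx algInt_val (Z x) *m map_mx algInt_val (Z y).
      exact: (map_mxM (val : {rmorphism _ -> _})).
    by rewrite !valZ ?groupM // YM // -scalemxAl -scalemxAr.
  have /(congr1 (map_mx red)) := ZM.
  rewrite map_mxZ map_mxM /X => ZM'; rewrite -scalemxAl -scalemxAr -ZM' !scalerA.
  by congr (_ *: _); rewrite -mulrA mulVf // mulr1.
exists (MxRepresentation Xrepr); split; first by rewrite cfRepr1.
move=> x Gx; have [e [[B uB defx] [e1 _] [defchi _] _]] := repr_rsim_diag rG Gx.
have ordx_gt0 : (0 < #[x])%N := order_gt0 x.
have Ae i : e 0 i \in Aint.
  by apply: (@Aint_unity_root #[x]) => //; apply/unity_rootP.
pose w i : algInt := AlgInt (Ae i).
have trZ : algInt_val (\tr (Z x)) = algInt_val S * cfRepr rG x.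
  rewrite cfunE Gx mulr1n.
  have -> : algInt_val (\tr (Z x)) = \tr (map_mx algInt_val (Z x)).
    by rewrite (trace_map_mx (val : {rmorphism _ -> _})).
  by rewrite valZ // linearZ /= /Y mxtrace_mulC mulmxA mulVmx ?mul1mx.
exists [seq w i | i : 'I_n]; split.
- move=> _ /mapP[i _ ->]; apply: val_inj.
  by rewrite (rmorphXn (val : {rmorphism _ -> _})) rmorph1; apply: e1.
- rewrite big_image /=.
  have cpY : char_poly (Y x) = \prod_i ('X - (e 0 i)%:P).
    rewrite char_poly_conj // defx -{2}[B]invmxK char_poly_conj ?unitmx_inv //.
    rewrite char_poly_trig ?diag_mx_is_trig //; apply: eq_bigr => i _.
    by rewrite mxE eqxx mulr1n.
  (* This identity over [algInt] is checked after the injection into [algC], and is then transported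
     to [F] by [red]. *)
  have scZ : scaled_char_poly S (Z x) = S%:P ^+ n * \prod_i ('X - (w i)%:P).
    have [vm vmE] : exists vm : {rmorphism algInt -> algC}, vm =1 algInt_val.
      by exists val.
    apply: (@map_inj_poly _ _ vm); last by rewrite map_scaled_char_poly;
      have -> : map_mx vm (Z x) = vm S *: Y x;
      [by rewrite vmE -valZ //; apply: eq_map_mx|];
      rewrite scaled_char_polyE cpY rmorphM rmorphXn /= map_polyC rmorph_prod;
      congr (_ * _); apply: eq_bigr => i _;
      by rewrite rmorphB /= map_polyX map_polyC /= vmE.
    - by move=> a b; rewrite !vmE; apply: val_inj.
    - exact: rmorph0.
  have nzSn : (red S)%:P ^+ n != 0 by rewrite expf_neq0 // polyC_eq0.
  apply: (mulfI nzSn); rewrite -scaled_char_polyE.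
  have -> : red S *: X x = map_mx red (Z x) by rewrite /X scalerA mulfV ?scale1r.
  rewrite -map_scaled_char_poly scZ rmorphM rmorphXn /= map_polyC rmorph_prod.
  by congr (_ * _); apply: eq_bigr => i _; rewrite rmorphB /= map_polyX map_polyC.
- by rewrite defchi big_image.
have chiA : cfRepr rG x \in Aint by apply: Aint_char; apply: cfRepr_char.
rewrite /= /X linearZ /= trace_map_mx /= -(redC_val (\tr (Z x))) trZ redCM ?(valP S) //.
by rewrite redC_val mulKf.
Qed.

End ReductionModP.

(** * Complex lifts of modular representations *)

(** Unlike the averaged formula this one does not divide by the order of [H], so it can be reduced
    even when that order vanishes in the residue field. *)
Lemma cfInd_rcosets gT (G H : {group gT}) (phi : 'CF(H)) x : H \subset G ->
  'Ind[G] phi x = \sum_(C in rcosets H G) phi (x ^ (repr C)^-1)%g.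
Proof.
move=> sHG; rewrite cfIndE //; apply: canLR (mulKf (neq0CG H)) _.
rewrite (reindex_inj invg_inj) /=.
rewrite (eq_bigl (fun y => y \in G)) => [|y]; last by rewrite groupV.
rewrite (set_partition_big _ (rcosets_partition sHG)) mulr_sumr.
apply: eq_bigr => C /rcosetsP[y Gy ->{C}].
have [z Hz ->] := rcosetP (mem_repr_rcoset H y).
rewrite mulr_natl -(card_rcoset H y) -sumr_const; apply: eq_bigr => _ /rcosetP[u Hu ->].
by rewrite !invMg !conjgM (cfunJ _ _ (groupVr Hu)) (cfunJ _ _ (groupVr Hz)).
Qed.

Section Lifts.

Variables (F : closedFieldType) (red : {rmorphism algInt -> F}) (p : nat).
Hypothesis pF : p \in [pchar F].
Variable gT : finGroupType.
Implicit Types G H K N T : {group gT}.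
Local Notation rep := (mx_representation F).
Local Notation redC := (redC red).

Definition lifts G n (V : rep G n) (chi : 'CF(G)) : Prop :=
  [/\ chi \is a character, chi 1%g = n%:R &
      forall x, x \in G -> \tr (V x) = redC (chi x)].

Lemma affords_reduction_lifts G n (X : rep G n) (chi : 'CF(G)) :
  chi \is a character -> affords_reduction red X chi -> lifts X chi.
Proof. by move=> chiN [chi1 chiX]; split=> // x /chiX[s []]. Qed.

Lemma redC_cfunD G (chi psi : 'CF(G)) x :
    chi \is a character -> psi \is a character ->
  redC ((chi + psi) x) = redC (chi x) + redC (psi x).
Proof. by move=> Nchi Npsi; rewrite cfunE redCD ?Aint_char. Qed.

Lemma redC_constt G (chi : 'CF(G)) x :
  chi \is a character -> x \in G -> redC (chi x) = redC (chi x.`_p^').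
Proof.
move=> Nchi Gx; have [n [X /(affords_reduction_lifts Nchi)[_ _ trX]]] :=
  exists_reduction red pF Nchi.
have Gx' : x.`_p^' \in G by rewrite groupX.
by rewrite -!trX // (mxtrace_constt_p' _ pF).
Qed.

Lemma redC_cfInd G H (psi psi' : 'CF(H)) x : H \subset G ->
    psi \is a character -> psi' \is a character ->
    (forall y, y \in H -> redC (psi y) = redC (psi' y)) ->
  redC ('Ind[G] psi x) = redC ('Ind[G] psi' x).
Proof.
move=> sHG Npsi Npsi' eq_psi; rewrite !cfInd_rcosets //.
rewrite !redC_sum => [|C _|C _]; rewrite ?Aint_char //.
apply: eq_bigr => C _; have [Hy | H'y] := boolP ((x ^ (repr C)^-1)%g \in H).
  exact: eq_psi.
by rewrite !cfun0.
Qed.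

(** The common lift forces equal degrees and equal traces, so independence of traces applies to the
    single representation [X]. *)
Lemma lifts_rsim G n (V : rep G n) m (X : rep G m) (chi : 'CF(G)) :
  mx_irreducible V -> lifts V chi -> lifts X chi -> mx_rsim X V.
Proof.
move=> irrV [_ chi1 trV] [_ chi1' trX].
have eq_mn : m = n.
  by apply/eqP; rewrite -(eqr_nat algC) -chi1 -chi1'.
have [] := @irr_trace_indep F gT G n V 'I_1 (fun=> m) (fun=> X) (fun=> 1) irrV.
- by move=> x Gx; rewrite big_ord1 mul1r trV ?trX.
- by rewrite eq_mn.
by [].
Qed.

Lemma char_poly_rsim G n m (V : rep G n) (X : rep G m) x :
  mx_rsim X V -> x \in G -> char_poly (X x) = char_poly (V x).
Proof.
case=> B eq_mn freeB homB Gx; have homBx := homB x Gx; move: B freeB homBx {homB}.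
move: (V x); rewrite -eq_mn => Vx B; rewrite row_free_unit => uB hB.
by rewrite -[X x](mulmxK uB) hB char_poly_conj.
Qed.

(** If [u] = y / z differs from 1, the sum of its first [k] powers is 0. If also [red u = 1], that
    sum reduces to [k], which is nonzero in [F]. The inverse of [z] is written [z ^+ k.-1]. *)
Lemma red_root_inj k (y z : algInt) :
    p^'.-nat k -> y ^+ k = 1 -> z ^+ k = 1 -> red y = red z -> y = z.
Proof.
move=> p'k yk1 zk1 eq_red; apply/eqP; apply: contraT => nyz.
have /andP[k_gt0 _] := p'k.
pose u := y * z ^+ k.-1.
have uz : u * z = y by rewrite -mulrA -exprSr prednK // zk1 mulr1.
have nu1 : u - 1 != 0.
  by apply: contra nyz; rewrite subr_eq0 => /eqP u1; rewrite -uz u1 mul1r.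
have uk1 : u ^+ k = 1 by rewrite exprMn yk1 -exprM mulnC exprM zk1 expr1n mulr1.
have sum0 : \sum_(i < k) u ^+ i = 0.
  have /(congr1 algInt_val) : (u - 1) * \sum_(i < k) u ^+ i = 0.
    by rewrite -subrX1 uk1 subrr.
  rewrite algInt_valM algInt_val0 => /eqP; rewrite mulf_eq0 => /orP[] /eqP u0.
    by case/eqP: nu1; apply: val_inj; rewrite [LHS]u0 [RHS]algInt_val0.
  by apply: val_inj; rewrite [LHS]u0 [RHS]algInt_val0.
have red_u : red u = 1.
  by rewrite rmorphM eq_red rmorphXn -exprS prednK // -rmorphXn zk1 rmorph1.
have /eqP := congr1 red sum0; rewrite rmorph0 rmorph_sum.
rewrite (eq_bigr (fun=> 1)) => [|i _]; last by rewrite rmorphXn red_u expr1n.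
rewrite sumr_const card_ord -(dvdn_pcharf pF) => p_k.
by have := pnat_coprime (pnat_id (pcharf_prime pF)) p'k; rewrite prime_coprime ?p_k ?(pcharf_prime pF).
Qed.

(** The product determines the multiset of reduced roots, and reduction is injective on [s ++ t];
    [g] is an inverse of it there. *)
Lemma sum_roots_red (s t : seq algInt) :
    {in s, forall z, p'_root_of_unity p z} ->
    {in t, forall z, p'_root_of_unity p z} ->
    \prod_(z <- s) ('X - (red z)%:P) = \prod_(z <- t) ('X - (red z)%:P) ->
  \sum_(z <- s) (z : algC) = \sum_(z <- t) (z : algC).
Proof.
move=> ps pt eq_prod.
have inj_red : {in s ++ t &, injective red}.
  move=> y z; rewrite !mem_cat => /orP sy /orP sz eq_yz.
  have [k p'k yk] : p'_root_of_unity p y by case: sy => [/ps|/pt].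
  have [l p'l zl] : p'_root_of_unity p z by case: sz => [/ps|/pt].
  apply: (@red_root_inj (k * l)) => //; first by rewrite pnatM p'k.
    by rewrite exprM yk expr1n.
  by rewrite mulnC exprM zl expr1n.
pose g y := algInt_val (nth 0 (s ++ t) (index y (map red (s ++ t)))).
have gK z : z \in s ++ t -> g (red z) = z.
  move=> stz; have st_red : red z \in map red (s ++ t) by apply: map_f.
  congr algInt_val; apply: inj_red => //.
    by rewrite mem_nth // -(size_map red) index_mem.
  by rewrite -(nth_map 0 0) ?nth_index // -(size_map red) index_mem.
have sumE r : {subset r <= s ++ t} ->
    \sum_(z <- r) (z : algC) = \sum_(y <- map red r) g y.
  move=> sub; rewrite big_map big_seq [RHS]big_seq; apply: eq_bigr => z rz.
  by rewrite gK ?sub.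
rewrite !sumE => [|z|z]; rewrite ?mem_cat; try by move->; rewrite ?orbT.
by apply: perm_big; apply: prod_XsubC_eq; rewrite !big_map.
Qed.

Lemma reduction_agree G n m (V : rep G n) (X : rep G m) (chi psi : 'CF(G)) x :
    mx_rsim X V -> affords_reduction red V chi -> affords_reduction red X psi ->
    x \in G -> p^'.-elt x ->
  psi x = chi x.
Proof.
move=> simXV [_ redV] [_ redX] Gx p'x.
have [s [ps cps -> _]] := redX x Gx; have [t [pt cpt -> _]] := redV x Gx.
apply: sum_roots_red => [z sz|z tz|].
- by exists #[x]; rewrite ?ps.
- by exists #[x]; rewrite ?pt.
by rewrite -cps -cpt (char_poly_rsim simXV).
Qed.

(** The reductions of both lifts are similar to [V], and the eigenvalues of a p-regular element lift
    uniquely to p'-roots of unity. *)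
Lemma lifts_agree G n (V : rep G n) (chi psi : 'CF(G)) x :
    mx_irreducible V -> lifts V chi -> lifts V psi -> x \in G -> p^'.-elt x ->
  psi x = chi x.
Proof.
move=> irrV Vchi Vpsi Gx p'x; have [[Nchi _ trchi] [Npsi _ trpsi]] := (Vchi, Vpsi).
have [n1 [X1 redX1]] := exists_reduction red pF Nchi.
have [n2 [X2 redX2]] := exists_reduction red pF Npsi.
have sim1 := lifts_rsim irrV Vchi (affords_reduction_lifts Nchi redX1).
have sim2 := lifts_rsim irrV Vpsi (affords_reduction_lifts Npsi redX2).
exact: (reduction_agree (mx_rsim_trans sim2 (mx_rsim_sym sim1))).
Qed.

(** By independence of traces one of the two reductions is similar to [V]. This excludes splitting
    the trace of [V] into two characters of smaller degree. *)
Lemma lifts_sum2 G n (V : rep G n) (chi psi : 'CF(G)) (d e : nat) :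
    mx_irreducible V -> chi \is a character -> psi \is a character ->
    chi 1%g = d%:R -> psi 1%g = e%:R -> (d <= n)%N -> (e <= n)%N ->
    (forall x, x \in G -> \tr (V x) = redC (chi x) + redC (psi x)) ->
  d = n \/ e = n.
Proof.
move=> irrV Nchi Npsi chi1 psi1 le_dn le_en trV.
have [n1 [X1 redX1]] := exists_reduction red pF Nchi.
have [n2 [X2 redX2]] := exists_reduction red pF Npsi.
have [_ chi1' tr1] := affords_reduction_lifts Nchi redX1.
have [_ psi1' tr2] := affords_reduction_lifts Npsi redX2.
have def_n1 : n1 = d by apply/eqP; rewrite -(eqr_nat algC) -chi1 -chi1'.
have def_n2 : n2 = e by apply/eqP; rewrite -(eqr_nat algC) -psi1 -psi1'.
pose m (b : bool) := if b then n1 else n2.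
pose X (b : bool) : rep G (m b) := if b as c return rep G (m c) then X1 else X2.
have [x Gx|[]|[] /mxrank_rsim] := @irr_trace_indep F gT G n V bool m X (fun=> 1) irrV.
- by rewrite big_bool /= !mul1r tr1 ?tr2 ?trV.
- by rewrite /= def_n1.
- by rewrite /= def_n2.
- by rewrite /= def_n1; left.
by rewrite /= def_n2; right.
Qed.

(** A proper decomposition of [chi] would write the trace of [V] as a sum of two reduced characters
    of degree less than [n]. *)
Lemma lifts_irr G n (V : rep G n) (chi : 'CF(G)) :
  mx_irreducible V -> lifts V chi -> chi \in irr G.
Proof.
move=> irrV [Nchi chi1 trV]; have [n_gt0 _] := (mx_irrP _).1 irrV.
have nzchi : chi != 0.
  by rewrite -(char1_eq0 Nchi) chi1 pnatr_eq0 -lt0n.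
have [i chi_i] := neq0_has_constt nzchi.
have [psi Npsi defchi] := constt_charP i Nchi chi_i.
have [psi0 | nzpsi] := eqVneq psi 0.
  by rewrite defchi psi0 addr0 mem_irr.
have [d def_d] : exists d : nat, 'chi_i 1%g = d%:R.
  by apply/natrP; apply: Cnat_irr1.
have [e def_e] : exists e : nat, psi 1%g = e%:R.
  by apply/natrP; apply: Cnat_char1.
have def_n : n = (d + e)%N.
  by apply/eqP; rewrite -(eqr_nat algC) natrD -def_d -def_e -chi1 defchi cfunE.
have d_gt0 : (0 < d)%N by rewrite lt0n -(pnatr_eq0 algC) -def_d irr1_neq0.
have e_gt0 : (0 < e)%N by rewrite lt0n -(pnatr_eq0 algC) -def_e char1_eq0.
have [||x Gx||] := lifts_sum2 irrV (irr_char i) Npsi def_d def_e.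
- by rewrite def_n leq_addr.
- by rewrite def_n leq_addl.
- by rewrite trV // {1}defchi redC_cfunD ?irr_char.
- by move=> eq_d; move: e_gt0; rewrite -(ltn_add2l d) addn0 -def_n eq_d ltnn.
by move=> eq_e; move: d_gt0; rewrite -(ltn_add2r e) add0n -def_n eq_e ltnn.
Qed.

Lemma lifts_all G :
    (forall n (V : rep G n), mx_irreducible V -> exists chi, lifts V chi) ->
  forall n (V : rep G n), exists chi, lifts V chi.
Proof.
move=> lift_irr n V; pattern n, V; apply: rep_ind => {n V}.
- move=> V; exists 0; split; rewrite ?rpred0 ?cfunE // => x _.
  by rewrite cfunE redC0 /mxtrace big_ord0.
- exact: lift_irr.
move=> n V U modU _ _ [chi [Nchi chi1 trU]] [psi [Npsi psi1 trU']].
exists (chi + psi); split; first by rewrite rpredD.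
  by rewrite cfunE chi1 psi1 -natrD factmod_rank.
by move=> x Gx; rewrite -(mxtrace_sub_fact_mod modU) trU ?trU' ?redC_cfunD.
Qed.

Lemma lifts_block G N (nsNG : N <| G) n (V : rep G n)
    (sH : socleType (subg_repr V (normal_sub nsNG))) (W : sH) T
    (sTG : T \subset G) (modW : mxmodule (subg_repr V sTG) W) (psi : 'CF(T)) :
    mx_irreducible V -> T :=: rstabs V W -> lifts (submod_repr modW) psi ->
  lifts V ('Ind[G] psi).
Proof.
move=> irrV defT [Npsi psi1 trW]; split; first exact: cfInd_char.
  by rewrite cfInd1 // psi1 -natrM -(Clifford_block_rank irrV defT).
move=> x Gx; rewrite (Clifford_block_trace irrV defT modW Gx) cfInd_rcosets //.
rewrite redC_sum => [|C _]; last exact: Aint_char.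
apply: eq_bigr => C _; case: ifPn => [Ty | T'y]; first exact: trW.
by rewrite cfun0 ?redC0.
Qed.

Lemma lifts_conjg G n (V : rep G n) (chi : 'CF(G)) g (nGg : g \in 'N(G)) :
  lifts V chi -> lifts (conjg_repr V nGg) (chi ^ g)%CF.
Proof.
case=> Nchi chi1 trV; split; first by rewrite cfConjg_char.
  by rewrite cfConjg1.
by move=> x Gx /=; rewrite cfConjgE // trV // memJ_norm ?groupV.
Qed.

Lemma lifts_Res G H (sHG : H \subset G) n (V : rep G n) (chi : 'CF(G)) :
  lifts V chi -> lifts (subg_repr V sHG) ('Res[H] chi).
Proof.
case=> Nchi chi1 trV; split; first exact: cfRes_char.
  by rewrite cfRes1.
by move=> x Hx; rewrite cfResE //= trV // (subsetP sHG).
Qed.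

Lemma lifts_mx_rsim G n m (V : rep G n) (X : rep G m) (chi : 'CF(G)) :
  mx_rsim X V -> lifts V chi -> lifts X chi.
Proof.
move=> simXV [Nchi chi1 trV]; split=> //; first by rewrite (mxrank_rsim simXV).
by move=> x Gx; rewrite -trV // (mxtrace_rsim simXV).
Qed.

End Lifts.

(** * The Clifford alternative: homogeneous restriction or induction *)

Section Homogeneous.

Variables (F : closedFieldType) (gT : finGroupType).
Implicit Types G H K M N T : {group gT}.
Local Notation rep := (mx_representation F).

Lemma emb_simple G n m (Y : rep G n) (X : rep G m) :
    mx_irreducible Y -> emb Y X ->
  exists U (simU : mxsimple X U), mx_rsim Y (submod_repr (mxsimple_module simU)).
Proof.
move=> irrY [B freeB homB]; pose U := <<B>>%MS.
have modU : mxmodule X U.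
  rewrite (eqmx_module _ (genmxE _)); apply/mxmoduleP=> x Gx.
  by rewrite -homB // submxMl.
have sBU : (B <= U)%MS by rewrite genmxE.
have simYU : mx_rsim Y (submod_repr modU).
  exists (in_submod U B) => [||x Gx].
  - by rewrite genmxE; apply/esym/eqP.
  - by rewrite /row_free mxrank_in_submod.
  by rewrite -in_submodJ // -homB // [RHS]in_submodE [in_submod U B]in_submodE mulmxA.
have simU : mxsimple X U by apply/(submod_mx_irr modU)/(mx_rsim_irr simYU).
exists U, simU; apply: mx_rsim_trans simYU _.
by apply/mx_rsim_iso; apply: mx_iso_refl.
Qed.

Definition homogeneous G N (sNG : N \subset G) n (V : rep G n) : Prop :=
  forall m (Y : rep N m) m' (Y' : rep N m'),
    mx_irreducible Y -> mx_irreducible Y' ->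
    emb Y (subg_repr V sNG) -> emb Y' (subg_repr V sNG) -> mx_rsim Y Y'.

Lemma emb_subg G H K (sHK : H \subset K) (sKG : K \subset G) (sHG : H \subset G)
    n m (Y : rep K n) (V : rep G m) :
  emb Y (subg_repr V sKG) -> emb (subg_repr Y sHK) (subg_repr V sHG).
Proof.
by case=> B freeB homB; exists B => // x Hx; apply: homB; apply: (subsetP sHK).
Qed.

Variable red : {rmorphism algInt -> F}.

(** [T] is the stabiliser of a homogeneous component [W]. If it were all of [G], that component
    would be the whole space and the restriction would be homogeneous. *)
Lemma homogeneous_or_induced G N (nsNG : N <| G) n (V : rep G n) :
    mx_irreducible V -> ~ homogeneous (normal_sub nsNG) V ->
  exists T (sTG : T \subset G) m (W : rep T m),
    [/\ N \subset T, T \proper G, mx_irreducible W,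
        emb W (subg_repr V sTG) & n = (#|G : T| * m)%N /\
        forall psi, lifts red W psi -> lifts red V ('Ind[G] psi)].
Proof.
move=> irrV nonhom; pose VN := subg_repr V (normal_sub nsNG).
have sH : socleType VN := DecSocleType VN.
have [W0 _ _] := imsetP (Clifford_atrans irrV sH).
pose W : sH := W0; pose T := [group of rstabs V W].
have sTG : T \subset G := rstabs_sub V W.
have simW : mxsimple (subg_repr V sTG) W := Clifford_rstabs_simple irrV W.
pose modW := mxsimple_module simW.
have rkV := @Clifford_block_rank F gT G N nsNG n V irrV sH W T erefl sTG.
exists T, sTG, (\rank W), (submod_repr modW); split.
- rewrite /T /= -Clifford_astab1; apply/subsetP=> h Nh.
  have : h \in 'C([set: sH] | Clifford_action sH).
    by apply: (subsetP (Clifford_astab sH)); rewrite mem_gen // inE Nh.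
  by move/(subsetP (astabS _ (subsetT [set W]))).
- rewrite properE sTG; apply/negP=> sGT; apply: nonhom => m Y m' Y' irrY irrY' embY embY'.
  have fullW : (1%:M <= W)%MS.
    rewrite sub1mx /row_full; apply/eqP.
    have : #|G : T| = 1%N by apply/eqP; rewrite indexg_eq1.
    by move=> iGT; move: rkV; rewrite iGT mul1n => /esym.
  have [U [simU simYU]] := emb_simple irrY embY.
  have [U' [simU' simYU']] := emb_simple irrY' embY'.
  have isoU Z : mxsimple VN Z -> mx_iso VN (socle_base W) Z.
    move=> simZ; apply: component_mx_iso => //; first exact: socle_simple.
    exact: submx_trans (submx1 _) fullW.
  apply: mx_rsim_trans simYU _; apply: mx_rsim_trans (mx_rsim_sym simYU').
  apply/mx_rsim_iso; apply: mx_iso_trans (isoU _ simU').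
  exact: mx_iso_sym (isoU _ simU).
- exact/submod_mx_irr.
- exact: emb_submod.
split=> // psi; exact: lifts_block.
Qed.

End Homogeneous.

(** * Lifting over an invariant character across an r-quotient, r != p *)

Section OverInvariant.

Variables (F : closedFieldType) (red : {rmorphism algInt -> F}) (p : nat).
Hypothesis pF : p \in [pchar F].
Variable gT : finGroupType.
Implicit Types G H K L M N T : {group gT}.
Local Notation rep := (mx_representation F).
Local Notation redC := (redC red).

(* All irreducible constituents of chi have the form b tau with b a character
   of L / M, and b is constant on the cosets of M. *)
Lemma over_coset_multiple L M (theta : 'CF(M)) (tau chi : 'CF(L)) a x :
    M <| L -> theta \in irr M -> tau \in irr L -> 'Res[M] tau = theta ->
    chi \is a character -> 'Res[M] chi = a *: theta -> x \in L ->
  exists c, forall m, m \in M -> chi (m * x)%g = c * tau (m * x)%g.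
Proof.
move=> nsML /irrP[i ->{theta}] /irrP[t ->{tau}] res_tau Nchi res_chi Lx.
have [_ _ constt_Ind _] := constt_Ind_ext nsML res_tau.
have nML := normal_norm nsML; have sML := normal_sub nsML.
pose Q (phi : 'CF(L)) := exists c, forall m, m \in M ->
  phi (m * x)%g = c * 'chi_t (m * x)%g.
rewrite -/(Q chi) [chi]cfun_sum_constt; apply: (big_ind Q) => [|phi psi|j Sj].
- by exists 0 => m _; rewrite cfunE mul0r.
- move=> [c phiE] [d psiE]; exists (c + d) => m Mm.
  by rewrite cfunE phiE ?psiE // mulrDl.
have : j \in irr_constt ('Ind[L] 'chi_i).
  rewrite constt_Ind_Res; have [k Rk] : exists k, k \in irr_constt ('Res[M] 'chi_j).
    by apply: neq0_has_constt; rewrite cfRes_eq0 ?irr_char ?irr_neq0.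
  suff -> : i = k by [].
  apply/eqP; have := cfdot_Res_ge_constt k Nchi Sj; rewrite res_chi.
  rewrite cfdotZl cfdot_irr; case: eqP => // _; rewrite mulr0 => le0.
  have ge0 : 0 <= '['Res[M] 'chi_j, 'chi_k].
    by rewrite natr_ge0 // Cnat_cfdot_char ?cfRes_char ?irr_char.
  by have := Rk; rewrite irr_consttE eq_le le0 ge0.
rewrite constt_Ind => /codomP[b ->].
have [irrM _ _ _] := constt_Ind_ext nsML res_tau.
move: '[chi, _] => e; exists (e * 'chi_b (coset M x)) => m Mm.
rewrite cfunE -[RHS]mulrA; congr (_ * _).
rewrite /mul_mod_Iirr /mul_Iirr cfIirrE ?irrM // cfunE mod_IirrE //.
rewrite cfModE ?groupM ?(subsetP sML m) //.
by rewrite coset_kerl.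
Qed.

Variables (N M : {group gT}) (r : nat) (theta : 'CF(M)).
Hypotheses (nsMN : M <| N) (pr_r : prime r) (neq_rp : r != p).
Hypothesis sN'M : (N^`(1))%g \subset M.
Hypothesis expr : forall x, x \in N -> (x ^+ r)%g \in M.
Hypotheses (irr_th : theta \in irr M) (IN : N \subset 'I[theta]).
Variables (d : nat) (U0 : rep M d).
Hypotheses (irrU0 : mx_irreducible U0) (liftU0 : lifts red U0 theta).

(** Since [x ^+ r] lies in [M], the index of [M] in [L] is 1 or [r], and an invariant irreducible
    character extends over a prime index. *)
Lemma cyclic_extension (L : {group gT}) x : L :=: M <*> <[x]> -> x \in N ->
  exists2 tau : 'CF(L), tau \in irr L & 'Res[M] tau = theta.
Proof.
move=> defL Nx; have nMN := normal_norm nsMN; have nMx := subsetP nMN x Nx.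
have nsML : M <| L by rewrite defL normalYl // cycle_subG.
have [i def_th] := irrP irr_th.
have [Mx | M'x] := boolP (x \in M).
  have eqLM : L = M.
    by apply/val_inj; rewrite /= defL; apply/joing_idPl; rewrite cycle_subG.
  by subst L; exists theta; rewrite ?cfRes_id.
have iLM : #|L : M| = r.
  rewrite -card_quotient ?normal_norm // defL quotientYidl ?cycle_subG //.
  rewrite quotient_cycle // -orderE; apply/(prime_nt_dvdP pr_r).
    by rewrite order_eq1; apply: contra M'x => /eqP /coset_idr ->.
  by rewrite order_dvdn -morphX //= coset_id ?expr.
have IL : L \subset 'I['chi_i].
  apply: subset_trans (_ : N \subset _); last by rewrite -def_th.
  by rewrite defL join_subG (normal_sub nsMN) cycle_subG.
have [t res_t] := prime_invariant_irr_extendible nsML iLM pr_r IL.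
by exists 'chi_t; rewrite ?mem_irr // res_t def_th.
Qed.

(** On the coset of [x] both characters are multiples of an extension [tau] of [theta]. The
    reduction of [tau] is nonzero somewhere on the coset, hence also at the p'-part of that point;
    as this p'-part stays in the coset, the two multiples agree. *)
Lemma over_eq_p'elts K (chi psi : 'CF(K)) a b :
    M \subset K -> K \subset N -> chi \is a character -> psi \is a character ->
    'Res[M] chi = a *: theta -> 'Res[M] psi = b *: theta ->
    (forall x, x \in K -> p^'.-elt x -> chi x = psi x) ->
  chi = psi.
Proof.
move=> sMK sKN Nchi Npsi res_chi res_psi eq_p'; apply/cfun_inP=> x Kx.
have Nx := subsetP sKN x Kx; have nMx := subsetP (normal_norm nsMN) x Nx.
have [L defL] : exists L : {group gT}, L :=: M <*> <[x]>.
  by exists (M <*> <[x]>)%G.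
have [tau irr_tau res_tau] := cyclic_extension defL Nx.
have nsML : M <| L by rewrite defL normalYl // cycle_subG.
have sLK : L \subset K by rewrite defL join_subG sMK cycle_subG.
have sML := normal_sub nsML.
have Lx : x \in L by rewrite -cycle_subG defL joing_subr.
have over (f : 'CF(K)) c : f \is a character -> 'Res[M] f = c *: theta ->
    exists e, forall m, m \in M -> f (m * x)%g = e * tau (m * x)%g.
  move=> Nf res_f; have res_f' : 'Res[M] ('Res[L] f) = c *: theta.
    by rewrite (cfResRes _ sML sLK).
  have [e fE] := over_coset_multiple nsML irr_th irr_tau res_tau
    (cfRes_char L Nf) res_f' Lx.
  exists e => m Mm; have Lmx : (m * x)%g \in L by rewrite groupM // (subsetP sML).
  by rewrite -(fE m Mm) (cfResE f sLK Lmx).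
have [e chiE] := over _ _ Nchi res_chi; have [f psiE] := over _ _ Npsi res_psi.
have Ntau : tau \is a character := irrWchar irr_tau.
have [n [X redX]] := exists_reduction red pF Ntau.
have liftX := affords_reduction_lifts Ntau redX.
have irrX : mx_irreducible (subg_repr X sML).
  have liftXM := lifts_Res sML liftX; rewrite res_tau in liftXM.
  exact: mx_rsim_irr (mx_rsim_sym (lifts_rsim irrU0 liftU0 liftXM)) irrU0.
have [m Mm nz_tr] := irr_trace_coset_neq0 irrX Lx.
pose y := (m * x)%g; have Ly : y \in L by rewrite groupM // (subsetP sML).
have [_ _ trX] := liftX.
have nz_y' : redC (tau y.`_p^') != 0.
  by rewrite -(redC_constt red pF Ntau Ly) -trX.
(* The p-part of [y] has order prime to [r], so it is a power of its own [r]-th power, which lies in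
   [M]. *)
have [m' Mm' def_y'] : exists2 m', m' \in M & y.`_p^' = (m' * x)%g.
  have Myp : y.`_p \in M.
    have Ny : y \in N by rewrite (subsetP sKN) // (subsetP sLK).
    have Nyp : y.`_p \in N by rewrite groupX.
    have co_yr : coprime #[y.`_p] r.
      apply: pnat_coprime (p_elt_constt p y) _.
      by rewrite pnatE // inE /= inE.
    have := generator_coprime y.`_p r; rewrite co_yr => /eqP gen.
    by rewrite -cycle_subG gen cycle_subG expr.
  exists ((y.`_p)^-1 * m)%g; first by rewrite groupM ?groupV.
  by apply: (mulgI y.`_p); rewrite consttC -mulgA mulKVg.
have p'y' : p^'.-elt (m' * x)%g by rewrite -def_y' p_elt_constt.
have Ky' : (m' * x)%g \in K by rewrite groupM // (subsetP sMK).
have := eq_p' _ Ky' p'y'; rewrite chiE // psiE // => /mulIf eq_ef.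
rewrite -[x]mul1g chiE // psiE // eq_ef //.
by apply: contraNneq nz_y' => tau0; rewrite def_y' tau0 redC0.
Qed.

Lemma rsim_emb G n m (X : rep G n) (Y : rep G m) : mx_rsim X Y -> emb X Y.
Proof. by case=> B _ freeB homB; exists B. Qed.

Lemma prime_root_primitive (R : idomainType) (z : R) :
  z ^+ r = 1 -> z != 1 -> r.-primitive_root z.
Proof.
move=> zr1 nz1; have [m prim_m dv_m] := prim_order_exists (prime_gt0 pr_r) zr1.
have /primeP[_ /(_ m dv_m) /pred2P[m1 | <- //]] := pr_r.
by have := prim_expr_order prim_m; rewrite m1 expr1 => /eqP; rewrite (negPf nz1).
Qed.

Lemma redC_root_neq1 (w : algC) : w ^+ r = 1 -> w != 1 -> redC w != 1.
Proof.
move=> wr1; apply: contra => /eqP red1.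
have Aw : w \in Aint.
  by apply: (Aint_unity_root (prime_gt0 pr_r)); apply/unity_rootP.
have w1 : AlgInt Aw = 1.
  apply: (@red_root_inj _ red _ pF r); rewrite ?expr1n //.
  - by rewrite pnatE // inE /= inE.
  - by apply: val_inj; rewrite (rmorphXn (val : {rmorphism _ -> _})) rmorph1.
  have -> : red (AlgInt Aw) = redC w := esym (redC_val red (AlgInt Aw)).
  by rewrite red1 rmorph1.
by rewrite -[w]/(algInt_val (AlgInt Aw)) w1 algInt_val1.
Qed.

(** The inflation of a nontrivial linear character of the quotient; the reduction of its value at
    [g] will be the primitive root used by [twist_trace]. *)
Lemma prime_quotient_lin_char (K M1 : {group gT}) g :
    M1 <| K -> #|K : M1| = r -> g \in K -> (g ^+ r)%g \in M1 ->
    (forall x, x \in K -> exists a i, a \in M1 /\ x = (a * g ^+ i)%g) ->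
  exists2 la : 'CF(K), la \is a linear_char &
    [/\ la g != 1, la g ^+ r = 1 & forall a i, a \in M1 ->
        la (a * g ^+ i)%g = la g ^+ i].
Proof.
move=> nsMK iKM Kg Mgr defK; have sMK := normal_sub nsMK.
have cardQ : #|K / M1|%g = r by rewrite card_quotient ?normal_norm.
have abQ : abelian (K / M1) by rewrite cyclic_abelian // prime_cyclic ?cardQ.
have [b nzb] : exists b : Iirr (K / M1), b != 0.
  apply/existsP; rewrite -negb_forall; apply/negP=> /forallP all0.
  have : #|Iirr (K / M1)| = r by rewrite card_Iirr_abelian.
  rewrite (eq_card (_ : _ =i pred1 0)) => [|b]; last by rewrite !inE all0.
  by rewrite card1 => r1; move: pr_r; rewrite -r1.
pose la := 'chi_(mod_Iirr b) : 'CF(K).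
have lin_la : la \is a linear_char.
  rewrite /la mod_IirrE // cfMod_lin_char //.
  exact: (char_abelianP _ abQ b).
have laM a : a \in M1 -> la a = 1.
  move=> Ma; rewrite -(lin_char1 lin_la); apply: cfker1.
  by rewrite /la mod_IirrE // (subsetP (cfker_mod _ nsMK)).
have laE a i : a \in M1 -> la (a * g ^+ i)%g = la g ^+ i.
  move=> Ma; rewrite lin_charM ?groupX ?(subsetP sMK a) // laM // mul1r.
  by rewrite lin_charX.
exists la => //; split=> //; last by rewrite -lin_charX // laM.
apply: contra nzb => /eqP la1; rewrite -(mod_Iirr_eq0 b nsMK) -irr_eq1.
apply/eqP/cfun_inP=> x /defK[a [i [Ma ->]]].
have Kx : (a * g ^+ i)%g \in K by rewrite groupM ?groupX ?(subsetP sMK a).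
by rewrite -/la laE // la1 expr1n cfun1E Kx.
Qed.

(** Induction on the order of [K] through a maximal subgroup [M1] above [M], of index [r]. Either
    [U] is induced from [M1], or the lift of a constituent on [M1] is invariant, extends to [K], and
    a linear twist of the extension lifts [U]. The degree is multiplied by [r] or unchanged, so it
    stays prime to [p]. *)
Lemma over_lift_exists K (sMK : M \subset K) n (U : rep K n) :
    K \subset N -> p^'.-nat d -> mx_irreducible U ->
    (forall m (Y : rep M m), mx_irreducible Y -> emb Y (subg_repr U sMK) ->
       lifts red Y theta) ->
  exists chi, [/\ lifts red U chi, exists a, 'Res[M] chi = a *: theta
                & p^'.-nat n].
Proof.
move=> sKN p'd; have [k] := ubnP #|K|.
elim: k => // k IHk in K sMK n U sKN *; rewrite ltnS => leKk irrU overU.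
have [n_gt0 _] := (mx_irrP _).1 irrU.
have [defM | [M1 maxM1 sMM1]] := maximal_exists sMK.
  have eqKM : K = M by apply/val_inj.
  subst K; exists theta.
  have lift_th : lifts red U theta by apply: overU => //; exact: emb_refl.
  have [_ th1 _] := lift_th; have [_ th1' _] := liftU0.
  split=> //; first by exists 1; rewrite cfRes_id scale1r.
  suff -> : n = d by [].
  by apply/eqP; rewrite -(eqr_nat algC) -th1 -th1'.
have [sM1K0 not_sKM1] := andP (maxgroupp maxM1 : M1 \proper K).
have nsM1K : M1 <| K.
  apply: sub_der1_normal => //; apply: subset_trans sMM1.
  exact: subset_trans (dergS 1 sKN) sN'M.
pose sM1K := normal_sub nsM1K.
have ltM1 : (#|M1| < k)%N.
  by apply: leq_trans leKk; apply: proper_card; apply: (maxgroupp maxM1).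
have sM1N := subset_trans sM1K sKN.
have [g Kg M1'g] := subsetPn not_sKM1.
have Ng := subsetP sKN g Kg; have M1gr := subsetP sMM1 _ (expr Ng).
have defKM : (M1 * <[g]>)%g = K.
  by apply: mulg_normal_maximal => //; rewrite cycle_subG.
have defK x : x \in K -> exists a i, a \in M1 /\ x = (a * g ^+ i)%g.
  rewrite -[x \in K]/(x \in (K : {set gT})) -defKM.
  by case/mulsgP=> a _ Ma /cycleP[i ->] ->; exists a, i.
have iKM1 : #|K : M1| = r.
  have nM1g : g \in 'N(M1) := subsetP (normal_norm nsM1K) g Kg.
  rewrite -card_quotient ?normal_norm // -[in LHS]defKM quotientMidl.
  rewrite quotient_cycle // -orderE; apply/(prime_nt_dvdP pr_r).
    by rewrite order_eq1; apply: contra M1'g => /eqP /coset_idr ->.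
  by rewrite order_dvdn -morphX //= coset_id.
have IH m (W : rep M1 m) : mx_irreducible W ->
    emb W (subg_repr U sM1K) ->
  exists chi, [/\ lifts red W chi, exists a, 'Res[M] chi = a *: theta
                & p^'.-nat m].
  move=> irrW embW; apply: (IHk M1 sMM1) => // m' Y irrY embY.
  by apply: overU => //; apply: emb_trans embY _; apply: emb_subg embW.
have [homU | nonhomU] := classic (homogeneous (normal_sub nsM1K) U); last first.
  have [T [sTK [m [W [sM1T ltTK irrW embW [def_n liftW]]]]]] :=
    homogeneous_or_induced red irrU nonhomU.
  (* [T] is a proper subgroup of [K] containing the maximal subgroup [M1]. *)
  have defT : M1 = T.
    have [_ maxP] := maxgroupP maxM1.
    by apply/val_inj/esym/maxP.
  move: sTK W irrW embW def_n liftW; rewrite -defT => sTK W irrW embW def_n liftW.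
  have [psi [lift_psi [a res_psi] p'm]] := IH _ W irrW embW.
  exists ('Ind[K] psi); split; first exact: liftW.
    exists (#|K : M1|%:R * a); apply/cfun_inP=> x Mx.
    have Mxy y : y \in K -> psi (x ^ y^-1)%g = a * theta x.
      move=> Ky; have Ny := subsetP sKN y Ky.
      have nMy := subsetP (normal_norm nsMN) y Ny.
      have Mxy : (x ^ y^-1)%g \in M by rewrite memJ_norm ?groupV.
      rewrite -(cfResE psi sMM1 Mxy) res_psi cfunE; congr (_ * _).
      by apply: inertia_valJ; rewrite (subsetP IN) ?groupV.
    rewrite cfResE ?cfInd_rcosets ?(subset_trans sMM1) // cfunE.
    rewrite (eq_bigr (fun=> a * theta x)) => [|C /rcosetsP[y Ky ->]].
      by rewrite sumr_const -mulrA mulr_natl.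
    rewrite Mxy //; have [z M1z ->] := rcosetP (mem_repr_rcoset M1 y).
    by rewrite groupM // (subsetP sM1K).
  by rewrite def_n pnatM p'm andbT iKM1 pnatE // inE /= inE.
have [m [Y irrY embY]] := irr_emb_exists (subg_repr U sM1K) n_gt0.
have [zeta [lift_zeta [a res_zeta] p'm]] := IH _ Y irrY embY.
have [Nzeta _ _] := lift_zeta.
(* By homogeneity [zeta] and its conjugate lift the same [Y], so they agree on p-regular elements;
   both restrict to [a *: theta]. *)
have Izeta : K \subset 'I[zeta].
  apply/subsetP=> y Ky; have nM1y := subsetP (normal_norm nsM1K) y Ky.
  have Ny := subsetP sKN y Ky.
  rewrite inE nM1y /=; apply/eqP; have irrYy := conjg_repr_irr nM1y irrY.
  have lift_y : lifts red Y (zeta ^ y)%CF.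
    apply: lifts_mx_rsim (lifts_conjg nM1y lift_zeta).
    by apply: homU => //; apply: emb_conjg embY.
  apply: (over_eq_p'elts (a := a) (b := a) sMM1 sM1N) => //.
  - by rewrite cfConjg_char.
  - apply/cfun_inP=> x Mx; have nMy := subsetP (normal_norm nsMN) y Ny.
    have Mxy : (x ^ y^-1)%g \in M by rewrite memJ_norm ?groupV.
    rewrite cfResE // cfConjgE // -(cfResE zeta sMM1 Mxy) res_zeta !cfunE.
    by congr (_ * _); apply: inertia_valJ; rewrite (subsetP IN) ?groupV.
  by move=> x M1x p'x; apply: (lifts_agree pF irrY lift_zeta lift_y).
have [i def_zeta] := irrP (lifts_irr pF irrY lift_zeta).
rewrite def_zeta in Izeta res_zeta lift_zeta *.
have [t res_t] := prime_invariant_irr_extendible nsM1K iKM1 pr_r Izeta.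
have [e [X redX]] := exists_reduction red pF (irr_char t).
have liftX := affords_reduction_lifts (irr_char t) redX.
have liftXM := lifts_Res sM1K liftX; rewrite res_t in liftXM.
have simXY := lifts_rsim irrY lift_zeta liftXM.
have irrX := mx_rsim_irr (mx_rsim_sym simXY) irrY.
have [la lin_la [la1 lar laE]] := prime_quotient_lin_char nsM1K iKM1 Kg M1gr defK.
have Ala x : la x \in Aint by apply: Aint_char; apply: lin_charW.
have prim_z : r.-primitive_root (redC (la g)).
  apply: prime_root_primitive; last exact: redC_root_neq1.
  by rewrite -redCX // lar redC1.
have embX := emb_trans (rsim_emb simXY) embY.
have [eq_en [j trU]] := twist_trace Kg M1gr prim_z defK irrX irrU embX.
(* The multiplier relating the traces of [U] and [X] is the reduction of [la ^+ j]. *)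
exists (la ^+ j * 'chi_t); split; last by rewrite -eq_en (mxrank_rsim simXY).
- have [Nt t1 trX] := liftX; split.
  + by rewrite rpredM // rpredX // lin_charW.
  + by rewrite cfunE exp_cfunE // lin_char1 // expr1n mul1r t1 eq_en.
  move=> x /defK[b [l [Mb ->]]]; rewrite trU // trX ?groupM ?groupX ?(subsetP sM1K b) //.
  rewrite cfunE exp_cfunE ?groupM ?groupX ?(subsetP sM1K b) // redCM ?rpredX ?Ala ?Aint_irr //.
  by rewrite laE // !redCX ?rpredX // -!exprM mulnC.
exists a; rewrite -res_zeta; apply/cfun_inP=> x Mx.
have M1x := subsetP sMM1 x Mx; have Kx := subsetP sM1K x M1x.
rewrite !cfResE // -res_t cfResE // cfunE exp_cfunE //.
have := laE x 0%N M1x; rewrite expg0 mulg1 expr0 => ->.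
by rewrite expr1n mul1r.
Qed.

End OverInvariant.

(** * The Fong-Swan theorem *)

Lemma cfDet_order_conjg gT (N : {group gT}) (phi : 'CF(N)) g :
  ('o((phi ^ g)%CF)%CF %| 'o(phi)%CF)%N.
Proof.
rewrite /cfDet_order dvdn_cforder cfDetConjg -rmorphXn /=.
by rewrite exp_cforder rmorph1.
Qed.

Section FongSwan.

Variables (F : closedFieldType) (red : {rmorphism algInt -> F}) (p : nat).
Hypothesis pF : p \in [pchar F].
Variable gT : finGroupType.
Implicit Types G H K L M N T : {group gT}.
Local Notation rep := (mx_representation F).
Local Notation redC := (redC red).

(* An element of N and its p'-part, which lies in M, have the same trace. *)
Lemma p_quotient_lift M N (nsMN : M <| N) (i : Iirr M) (c : Iirr N) n (U : rep N n) :
    p.-group (N / M) -> 'Res[M] 'chi_c = 'chi_i -> mx_irreducible U ->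
    (forall m (Y : rep M m), mx_irreducible Y ->
       emb Y (subg_repr U (normal_sub nsMN)) -> lifts red Y 'chi_i) ->
  lifts red U 'chi_c.
Proof.
move=> pNM res_c irrU overU; have [n_gt0 _] := (mx_irrP _).1 irrU.
have [d def_d] : exists d : nat, 'chi_i 1%g = d%:R.
  by apply/natrP; apply: Cnat_irr1.
have sMN := normal_sub nsMN.
have [|e [def_n trU]] := @homogeneous_trace F gT N M nsMN n U (fun x => redC ('chi_i x)) d irrU.
  move=> m Y irrY embY; have [_ chi1 trY] := overU m Y irrY embY; split=> //.
  by apply/eqP; rewrite -(eqr_nat algC) -chi1 def_d.
have [m [X redX]] := exists_reduction red pF (irr_char c).
have liftX := affords_reduction_lifts (irr_char c) redX; have [_ c1 trX] := liftX.
have def_m : m = d.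
  by apply/eqP; rewrite -(eqr_nat algC) -c1 -def_d -res_c cfRes1.
have simXU : mx_rsim X U.
  have [x Nx||//] := @irr_trace_indep F gT N n U 'I_1 (fun=> m) (fun=> X) (fun=> e%:R) irrU; last first.
  - move=> _; rewrite def_m def_n leq_pmull // lt0n.
    by apply: contraTneq n_gt0 => e0; rewrite def_n e0.
  have Nx' : x.`_p^' \in N by rewrite groupX.
  have Mx' : x.`_p^' \in M.
    have nMx : x.`_p^' \in 'N(M) := subsetP (normal_norm nsMN) _ Nx'.
    apply: coset_idr => //; apply/eqP; rewrite -order_eq1; apply/eqP.
    apply: (pnat_1 (mem_p_elt pNM (mem_quotient M Nx'))).
    by apply: morph_p_elt; rewrite ?p_elt_constt.
  rewrite big_ord1 (mxtrace_constt_p' _ pF Nx) (mxtrace_constt_p' X pF Nx).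
  by rewrite trU // trX // -res_c cfResE.
exact: lifts_mx_rsim (mx_rsim_sym simXU) liftX.
Qed.

(** The conditions on degree and determinantal order are carried along because the coprime extension
    theorem requires them at the p-factors of the series. *)
Lemma quasi_primitive_lift G n (V : rep G n) :
    solvable G -> mx_irreducible V ->
    (forall N (nsNG : N <| G), homogeneous (normal_sub nsNG) V) ->
  forall N (nsNG : N <| G), exists i : Iirr N,
    [/\ G \subset 'I['chi_i],
        exists2 d : nat, 'chi_i 1%g = d%:R & p^'.-nat d,
        p^'.-nat 'o('chi_i)%CF
      & forall m (Y : rep N m), mx_irreducible Y ->
          emb Y (subg_repr V (normal_sub nsNG)) -> lifts red Y 'chi_i].
Proof.
move=> solG irrV homV N nsNG; have [n_gt0 _] := (mx_irrP _).1 irrV.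
have [k] := ubnP #|N|; elim: k => // k IHk in N nsNG *; rewrite ltnS => leNk.
have [sNG nNG] := andP nsNG.
have [N1 | ntN] := eqVneq (N : {set gT}) 1%g.
  have eqN : N = 1%G by apply/val_inj.
  subst N; exists 0; split.
  - by rewrite inertia_irr0.
  - by exists 1%N; rewrite // irr0 cfun11.
  - by apply: pnat_dvd (cfDet_order_dvdG _) _; rewrite cards1.
  move=> m Y irrY _; have m1 : m = 1%N.
    apply: (mx_irr_abelian_linear _ irrY (abelian1 _)).
    exact: group_closure_closed_field.
  split; first exact: irr_char.
    by rewrite irr0 cfun11 m1.
  move=> x /set1P->; rewrite irr0 cfun11 redC1 repr_mx1 mxtrace1.
  by rewrite m1.
have [M maxM] : {M : {group gT} | maxnormal M N G}.
  by apply: ex_maxgroup; exists 1%G; rewrite proper1G ntN norms1.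
have [/andP[ltMN nMG] _] := maxgroupP maxM.
have sMN := proper_sub ltMN.
have nsMG : M <| G by rewrite /normal (subset_trans sMN sNG).
have nsMN : M <| N by rewrite /normal sMN (subset_trans sNG).
have ltMk : (#|M| < k)%N by apply: leq_trans leNk; apply: proper_card.
have [i [IGi [d def_d p'd] p'o liftM]] := IHk M nsMG ltMk.
have minNM : minnormal (N / M) (G / M).
  by apply: chief_factor_minnormal; rewrite /chief_factor maxM.
have [_ _ /is_abelemP[r pr_r abelNM]] :=
  minnormal_solvable minNM (subxx _) (quotient_sol M (solvableS sNG solG)).
have [rNM abNM _] := and3P abelNM.
have INi : N \subset 'I['chi_i] := subset_trans sNG IGi.
pose VN := subg_repr V sNG.
have overV m (Y : rep N m) m' (Z : rep M m') :
    emb Y (subg_repr V (normal_sub nsNG)) ->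
    mx_irreducible Z -> emb Z (subg_repr Y (normal_sub nsMN)) ->
  lifts red Z 'chi_i.
  move=> embY irrZ embZ; apply: liftM => //; apply: emb_trans embZ _.
  exact: emb_subg embY.
have [eq_rp | neq_rp] := eqVneq r p.
  have co_NM : coprime #|N : M| ('o('chi_i)%CF * Num.truncn ('chi_i 1%g)).
    rewrite -card_quotient ?normal_norm // def_d natrK.
    by rewrite (pnat_coprime rNM) // eq_rp pnatM p'o.
  have solNM : solvable (N / M) := quotient_sol M (solvableS sNG solG).
  have [c [res_c o_c uniq_c]] := extend_solvable_coprime_irr nsMN solNM INi co_NM.
  exists c; split.
  (* A conjugate of the canonical extension is again an extension with determinantal order prime to
     the index, so it is the same one. *)
  - apply/subsetP=> g Gg; rewrite inE (subsetP nNG) //=; apply/eqP.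
    rewrite -conjg_IirrE; congr ('chi_ _); apply: uniq_c.
      apply/cfun_inP=> x Mx; rewrite cfResE // conjg_IirrE cfConjgE ?(subsetP nNG) //.
      have Mxg : (x ^ g^-1)%g \in M by rewrite memJ_norm ?groupV ?(subsetP nMG).
      rewrite -(cfResE 'chi_c sMN Mxg) res_c.
      by apply: inertia_valJ; rewrite (subsetP IGi) ?groupV.
    rewrite conjg_IirrE; apply: coprime_dvdr (cfDet_order_conjg _ _) _.
    by rewrite o_c; move: co_NM; rewrite coprimeMr => /andP[].
  - by exists d => //; rewrite -def_d -res_c cfRes1.
  - by rewrite o_c.
  move=> m Y irrY embY; apply: p_quotient_lift res_c irrY _.
    by rewrite -eq_rp.
  by move=> m' Z irrZ embZ; apply: overV embY irrZ embZ.
have sN'M : (N^`(1))%g \subset M by rewrite der1_min ?normal_norm.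
have expr x : x \in N -> (x ^+ r)%g \in M.
  move=> Nx; have nMx := subsetP (normal_norm nsMN) x Nx.
  apply: coset_idr; first exact: groupX.
  by rewrite morphX //; have [_ ->] := abelemP pr_r abelNM; rewrite ?mem_quotient.
have [m [Y irrY embY]] := irr_emb_exists (subg_repr V (normal_sub nsNG)) n_gt0.
have [m_gt0 _] := (mx_irrP _).1 irrY.
have [m0 [U0 irrU0 embU0]] := irr_emb_exists (subg_repr Y (normal_sub nsMN)) m_gt0.
have liftU0 := overV _ _ _ _ embY irrU0 embU0.
have p'm0 : p^'.-nat m0.
  have [_ chi1 _] := liftU0; suff -> : m0 = d by [].
  by apply/eqP; rewrite -(eqr_nat algC) -chi1 def_d.
have [chi [lift_chi [a res_chi] p'm]] :=
  over_lift_exists pF nsMN pr_r neq_rp sN'M expr (mem_irr i) INi irrU0 liftU0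
    (subxx N) p'm0 irrY (fun m' Z => overV m Y m' Z embY).
have [j def_chi] := irrP (lifts_irr pF irrY lift_chi).
have [Nchi chi1 _] := lift_chi.
exists j; rewrite -def_chi; split.
- apply/subsetP=> g Gg; have nNg := subsetP nNG g Gg.
  rewrite inE nNg /=; apply/eqP.
  have lift_g : lifts red Y (chi ^ g)%CF.
    apply: lifts_mx_rsim (lifts_conjg nNg lift_chi).
    by apply: (homV N nsNG) => //; [apply: conjg_repr_irr | apply: emb_conjg].
  apply: (over_eq_p'elts pF nsMN pr_r neq_rp expr (mem_irr i) INi irrU0 liftU0
     (a := a) (b := a) sMN (subxx N)) => //.
  + by rewrite cfConjg_char.
  + apply/cfun_inP=> x Mx; rewrite cfResE // cfConjgE //.
    have Mxg : (x ^ g^-1)%g \in M by rewrite memJ_norm ?groupV ?(subsetP nMG).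
    rewrite -(cfResE chi sMN Mxg) res_chi !cfunE; congr (_ * _).
    by apply: inertia_valJ; rewrite (subsetP IGi) ?groupV.
  by move=> x Nx p'x; apply: (lifts_agree pF irrY lift_chi lift_g).
- by exists m.
- have [e def_a] : exists e : nat, a = e%:R.
    apply/natrP; have <- : '['Res[M] chi, 'chi_i] = a.
      by rewrite res_chi cfdotZl cfnorm_irr mulr1.
    by rewrite Cnat_cfdot_char ?cfRes_char ?irr_char.
  (* On [M] the determinant of [chi] is a power of that of ['chi_i], and [r]-th powers of elements
     of [N] lie in [M]; so the order divides this product. *)
  apply: (@pnat_dvd _ ('o('chi_i)%CF * r)); last first.
    by rewrite pnatM p'o pnatE // inE /= inE.
  rewrite /cfDet_order dvdn_cforder; apply/eqP/cfun_inP=> x Nx.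
  have lin_det := cfDet_lin_char chi.
  rewrite mulnC exprM exp_cfunE // exp_cfunE // -lin_charX //.
  have Mxr := expr x Nx; rewrite -(cfResE _ sMN Mxr) -cfDetRes // res_chi.
  rewrite def_a scaler_nat cfDetMn ?irr_char // -exp_cfunE // -exprM mulnC exprM.
  by rewrite exp_cforder expr1n !cfun1E Mxr Nx.
move=> m' Y' irrY' embY'; apply: lifts_mx_rsim lift_chi.
exact: homV irrY' irrY embY' embY.
Qed.

(** Induction on the order of [G]; in the quasi-primitive case the previous lemma is applied with
    [N] equal to [G]. *)
Theorem solvable_lift G n (V : rep G n) :
  solvable G -> mx_irreducible V -> exists chi, lifts red V chi.
Proof.
have [k] := ubnP #|G|; elim: k => // k IHk in G n V *; rewrite ltnS => leGk solG irrV.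
have [homV | nonhomV] :=
    classic (forall N (nsNG : N <| G), homogeneous (normal_sub nsNG) V).
  have [i [_ _ _ liftV]] := quasi_primitive_lift solG irrV homV (normal_refl G).
  by exists 'chi_i; apply: liftV => //; apply: emb_refl.
have [N nonhomN] := not_all_ex_not _ _ nonhomV.
have [nsNG nonhom] := not_all_ex_not _ _ nonhomN.
have [T [sTG [m [W [_ ltTG irrW _ [_ liftW]]]]]] :=
  homogeneous_or_induced red irrV nonhom.
have [|psi liftpsi] := IHk T m W _ (solvableS sTG solG) irrW.
  by apply: leq_trans leGk; apply: proper_card.
by exists ('Ind[G] psi); apply: liftW.
Qed.

End FongSwan.

(** * Pseudo-monomial groups *)

Section PseudoM.

Variable gT : finGroupType.
Implicit Types G H K : {group gT}.

Lemma exists_perfect_derived G : exists n, (G^`(n.+1) = G^`(n))%g.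
Proof.
apply: NNPP => no_n.
suff lt_der : forall n, (#|G^`(n)%g| + n <= #|G|)%N.
  by have := lt_der #|G|.+1; rewrite addnS ltnNge leq_addl.
elim=> [|n IHn]; first by rewrite derg0 addn0.
apply: leq_trans IHn; rewrite addnS -addSn leq_add2r; apply: proper_card.
rewrite properEneq der_subS andbT; apply/eqP=> eq_n; apply: no_n.
by exists n.
Qed.

Lemma constt_Res_char1 G K i j k : K <| G ->
    j \in irr_constt ('Res[K] 'chi[G]_i) -> k \in irr_constt ('Res[K] 'chi[G]_i) ->
  'chi_k 1%g = 'chi_j 1%g.
Proof.
move=> nsKG Rj Rk; have := Rk.
rewrite irr_consttE (Clifford_Res_sum_cfclass nsKG Rj) cfdotZl mulf_eq0 negb_or.
case/andP=> _; rewrite cfdot_suml => nz_sum.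
have [chi /cfclassP[y Gy ->] nz] : exists2 chi, chi \in ('chi_j ^: G)%CF &
    '[chi, 'chi_k] != 0.
  apply: NNPP => no_chi; case/eqP: nz_sum; rewrite big_seq big1 // => chi Cchi.
  by apply/eqP/negPn/negP=> nz; apply: no_chi; exists chi.
move: nz; rewrite -conjg_IirrE cfdot_irr pnatr_eq0 eqb0 negbK => /eqP <-.
by rewrite conjg_IirrE cfConjg1.
Qed.

(* As in Taketa's theorem, the constituents of 1_H^G have smaller degree than
   chi = psi^G, so by induction the perfect group K is contained in H; then the
   degrees of the constituents of chi_K divide all the psi(1). *)
Lemma pseudoM_group_perfect_cfker G K i :
    pseudoM_group G -> K <| G -> (K^`(1))%g = K -> K \subset cfker 'chi[G]_i.
Proof.
move=> pmG nsKG perfK; have sKG := normal_sub nsKG.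
have [d def_d] : exists d : nat, 'chi_i 1%g = d%:R.
  by apply/natrP; apply: Cnat_irr1.
elim/ltn_ind: d i def_d => d IHd i def_d.
have [j Rj] : exists j, j \in irr_constt ('Res[K] 'chi_i).
  by apply: neq0_has_constt; rewrite cfRes_eq0 ?irr_char ?irr_neq0.
suff j0 : j = 0 by apply: constt0_Res_cfker; rewrite // -j0.
have [e def_e] : exists e : nat, 'chi_j 1%g = e%:R.
  by apply/natrP; apply: Cnat_irr1.
suff e1 : e = 1%N.
  apply/eqP; rewrite -subGcfker -{1}perfK; apply: lin_char_der1.
  by rewrite qualifE /= irr_char def_e e1 eqxx.
(* It suffices that [e] divides every degree inducing ['chi_i]. *)
apply: (pmG _ (mem_irr i)) => n [H [_ [sHG /irrP[k ->] defchi def_n]]].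
have sKH : K \subset H.
  have [eqHG | ltHG] := eqVproper sHG; first by rewrite eqHG.
  have Nind : 'Ind[G, H] 1 \is a character by rewrite cfInd_char ?cfun1_char.
  have nz1 : (1 : 'CF(H)) != 0 by rewrite -irr0 irr_neq0.
  have S0 : 0 \in irr_constt ('Ind[G, H] 1).
    by rewrite irr_consttE -cfdot_Res_r irr0 cfRes_cfun1 // cfnorm1 oner_eq0.
  have [phi Nphi def_ind] := constt_charP 0 Nind S0.
  have ind1 : 'Ind[G, H] 1 1%g = #|G : H|%:R by rewrite cfInd1 // cfun11 mulr1.
  have sK_ind : K \subset cfker ('Ind[G, H] 1).
    rewrite cfkerE // subsetI sKG; apply/bigcapsP=> l Sl.
    have [-> | nz_l] := eqVneq l 0.
      by rewrite irr0 cfker_cfun1.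
    have [f def_f] : exists f : nat, 'chi_l 1%g = f%:R.
      by apply/natrP; apply: Cnat_irr1.
    apply: (IHd f _ l def_f); have Sl' : l \in irr_constt phi.
      have := Sl; rewrite !irr_consttE def_ind cfdotDl cfdot_irr.
      by rewrite [0 == l]eq_sym (negPf nz_l) add0r.
    have [phi' Nphi' def_phi] := constt_charP l Nphi Sl'.
    (* The induced character of degree |G : H| contains both the trivial character and ['chi_l], so
       the degree of ['chi_l] is below |G : H|, hence below [d]. *)
    rewrite -(ltr_nat algC) -def_f -def_d -defchi cfInd1 //.
    apply: lt_le_trans (_ : #|G : H|%:R <= _); last first.
      by rewrite ler_peMr ?ler0n // irr1_degree ler1n irr_degree_gt0.
    rewrite -ind1 def_ind def_phi !cfunE irr0 cfun11.
    by rewrite addrCA ltrDl ltr_wpDr ?ltr01 ?char1_ge0.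
  apply: subset_trans sK_ind _; rewrite cfker_Ind ?cfun1_char //.
  by rewrite (subset_trans (gcore_sub _ _)) ?cfker_cfun1.
have nsKH : K <| H := normalS sKH sHG nsKG.
have [l Rl] : exists l, l \in irr_constt ('Res[K] 'chi_k).
  by apply: neq0_has_constt; rewrite cfRes_eq0 ?irr_char ?irr_neq0.
have Rik : k \in irr_constt ('Res[H] 'chi_i).
  by rewrite -constt_Ind_Res defchi constt_irr inE.
have Rl' : l \in irr_constt ('Res[K] 'chi_i).
  have := constt_Res_trans (cfRes_char H (irr_char i)) Rik Rl.
  by rewrite cfResRes.
have [m def_m] := dvdn_constt_Res1_irr1 nsKH Rl.
have := def_n; rewrite def_m (constt_Res_char1 nsKG Rj Rl') def_e -natrM.
by move/eqP; rewrite eqr_nat => /eqP <-; rewrite dvdn_mull.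
Qed.

Lemma pseudoM_group_solvable G : pseudoM_group G -> solvable G.
Proof.
move=> pmG; have [n perfK] := exists_perfect_derived G.
apply/derivedP; exists n; apply/trivgP; rewrite -(TI_cfker_irr G).
apply/bigcapsP=> i _; apply: (@pseudoM_group_perfect_cfker G [group of G^`(n)%g]) => //.
exact: der_normal.
Qed.

End PseudoM.

(** * Passing from ordinary to Brauer characters *)

Section PseudoMonomial.

Variables (gT : finGroupType) (p : nat).
Implicit Types G H : {group gT}.

(** The restriction to p-regular elements, in the encoding of Brauer characters by class functions
    extended by 0. *)
Definition p'part_cfun G (chi : 'CF(G)) : 'CF(G) :=
  chi * '1_[set x in G | p^'.-elt x].

Lemma p'part_cfunE G (chi : 'CF(G)) x :
  p'part_cfun chi x = if p^'.-elt x then chi x else 0.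
Proof.
have [Gx | notGx] := boolP (x \in G); last by rewrite !cfun0 ?if_same.
rewrite cfunE cfuniE ?inE ?Gx /=; first by case: ifP; rewrite ?mulr1 ?mulr0.
apply/andP; split; first by apply/subsetP=> y; rewrite inE => /andP[].
apply/subsetP=> y Gy; rewrite inE; apply/subsetP=> _ /imsetP[z Az ->].
by move: Az; rewrite !inE p_eltJ => /andP[Gz ->]; rewrite groupJ.
Qed.

Lemma p'part_cfInd G H (psi : 'CF(H)) : H \subset G ->
  'Ind[G] (p'part_cfun psi) = p'part_cfun ('Ind[G] psi).
Proof.
move=> sHG; apply/cfunP=> x; rewrite p'part_cfunE !cfIndE //.
case: ifPn => p'x; last first.
  rewrite big1 ?mulr0 // => y _.
  by rewrite p'part_cfunE p_eltJ (negPf p'x).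
by congr (_ * _); apply: eq_bigr => y _; rewrite p'part_cfunE p_eltJ p'x.
Qed.

Variables (F : closedFieldType) (red : {rmorphism algInt -> F}).
Hypothesis pF : p \in [pchar F].

Lemma affords_reduction_brauer G n (X : mx_representation F G n) (chi : 'CF(G)) :
  affords_reduction red X chi -> affords_brauer p red X (p'part_cfun chi).
Proof.
case=> _ redX; split=> x Gx p'x; last by rewrite p'part_cfunE (negPf p'x).
have [s [s1 cp chix _]] := redX x Gx.
exists s; split=> //; last by rewrite p'part_cfunE p'x.
by move=> z sz; exists #[x]; last exact: s1.
Qed.

Lemma affords_brauer_inj G n m (V : mx_representation F G n)
    (X : mx_representation F G m) phi psi :
    mx_rsim X V -> affords_brauer p red V phi -> affords_brauer p red X psi ->
  phi = psi.
Proof.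
move=> simXV [Vphi Vphi0] [Xpsi Xpsi0]; apply/cfun_inP=> x Gx.
have [p'x | px] := boolP (p^'.-elt x); last by rewrite Vphi0 ?Xpsi0.
have [s [ps cps ->]] := Vphi x Gx p'x; have [t [pt cpt ->]] := Xpsi x Gx p'x.
by apply: (sum_roots_red pF ps pt); apply: etrans (esym cps) (etrans _ cpt); rewrite (char_poly_rsim simXV).
Qed.

Lemma inducing_reduction_irr G H n (V : mx_representation F G n) m
    (Y : mx_representation F H m) (psi : 'CF(H)) :
    solvable H -> H \subset G -> mx_irreducible V -> psi \is a character ->
    affords_reduction red Y psi -> lifts red V ('Ind[G] psi) ->
  mx_irreducible Y.
Proof.
move=> solH sHG irrV Npsi redY [_ ind1 trV].
have [_ psi1 trY] := affords_reduction_lifts Npsi redY.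
have [n_gt0 _] := (mx_irrP _).1 irrV.
have def_n : n = (#|G : H| * m)%N.
  by apply/eqP; rewrite -(eqr_nat algC) natrM -psi1 -ind1 cfInd1.
have nz1 : (1%:M : 'M[F]_m) != 0.
  by rewrite -mxrank_eq0 mxrank1; apply: contraTneq n_gt0 => m0; rewrite def_n m0 muln0.
have [|simY] := mxnonsimpleP Y nz1; last by apply/mxsimpleP; rewrite mxmodule1.
case=> U /and4P[modU _ nzU ltU]; rewrite mxrank1 in ltU.
have rkU_gt0 : (0 < \rank U)%N by rewrite lt0n mxrank_eq0.
have rk'U : (\rank (cokermx U) < m)%N.
  by rewrite -[X in (_ < X)%N](factmod_rank U) -{1}[\rank (cokermx U)]add0n ltn_add2r.
(* Neither the submodule nor the quotient need be irreducible, hence the lifting of arbitrary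
   representations of [H]. *)
have liftH k (Z : mx_representation F H k) : exists chi, lifts red Z chi.
  by apply: lifts_all => k' Z' irrZ'; exact: (solvable_lift red pF solH irrZ').
have [psi1' [Npsi1 psi11 tr1]] := liftH _ (submod_repr modU).
have [psi2' [Npsi2 psi21 tr2]] := liftH _ (factmod_repr modU).
have Aind k (f : 'CF(H)) : f 1%g = k%:R -> 'Ind[G] f 1%g = (#|G : H| * k)%:R.
  by move=> f1; rewrite cfInd1 // f1 natrM.
have iHG : (0 < #|G : H|)%N := indexg_gt0 G H.
have [/eqP|/eqP] : (#|G : H| * \rank U)%N = n \/ (#|G : H| * \rank (cokermx U))%N = n.
- apply: (lifts_sum2 pF irrV (cfInd_char G Npsi1) (cfInd_char G Npsi2)
    (Aind _ _ psi11) (Aind _ _ psi21)); rewrite ?def_n ?leq_pmul2l // 1?ltnW //.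
  move=> x Gx; rewrite trV // -redC_cfunD ?cfInd_char // -linearD /=.
  apply: redC_cfInd; rewrite ?rpredD // => y Hy.
  by rewrite redC_cfunD // -tr1 // -tr2 // mxtrace_sub_fact_mod trY.
- by rewrite def_n eqn_pmul2l // => /eqP eqU; rewrite eqU ltnn in ltU.
by rewrite def_n eqn_pmul2l // => /eqP eqU; rewrite eqU ltnn in rk'U.
Qed.

End PseudoMonomial.

Theorem theorem3 (gT : finGroupType) (G : {group gT}) :
  pseudoM_group G ->
  forall p : nat, prime p ->
  forall (F : closedFieldType) (red : {rmorphism algInt -> F}),
    residue_map p red -> pseudoMp_group p red G.
Proof.
move=> pmG p _ F red [pF _] phi [n [V [irrV brV]]].
have solG := pseudoM_group_solvable pmG.
have [chi lift_chi] := solvable_lift red pF solG irrV.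
have irr_chi := lifts_irr pF irrV lift_chi.
have [Nchi _ _] := lift_chi.
have [m [X redX]] := exists_reduction red pF Nchi.
have simXV := lifts_rsim irrV lift_chi (affords_reduction_lifts Nchi redX).
have def_phi : phi = p'part_cfun p chi.
  exact: (affords_brauer_inj pF simXV brV (affords_reduction_brauer p redX)).
(* Each degree inducing [chi] is also a degree inducing [phi], through the p-regular restriction of
   [psi]; a common divisor of the latter degrees therefore divides all the former. *)
move=> d dvd; apply: (pmG chi irr_chi) => k [H [psi [sHG irr_psi defchi psi1]]].
apply: dvd; exists H, (p'part_cfun p psi); split=> //.
- have Npsi := irrWchar irr_psi.
  have [l [Y redY]] := exists_reduction red pF Npsi.
  exists l, Y; split; last exact: affords_reduction_brauer.
  apply: (inducing_reduction_irr pF _ sHG irrV Npsi redY); last by rewrite defchi.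
  exact: solvableS solG.
- by rewrite p'part_cfInd // defchi.
by rewrite p'part_cfunE p_elt1.
Qed.
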